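(* Let $k\ge1$ be an integer, let $\lambda_1,\dots,\lambda_k>0$ and $\mu_1,\dots,\mu_k>0$, and let $0<\alpha\le1$. Then the generalized fractional Skellam process $\{\mathcal S^\alpha(t)\}_{t\ge0}$ with these rates exhibits the long-range dependence (LRD) property.
   Context: The generalized counting process (GCP) with positive rates $\lambda_1,\dots,\lambda_k$ is the counting process $\{M(t)\}_{t\ge0}$ with $M(0)=0$ that performs $k$ kinds of jumps of amplitude $1,2,\dots,k$ with rates $\lambda_1,\dots,\lambda_k$, respectively; equivalently it is (in law) the process $M(t)=\sum_{j=1}^k jN_j(t)$, where $N_1,\dots,N_k$ are independent Poisson processes with intensities $\lambda_1,\dots,\lambda_k$. The generalized Skellam process (GSP) is $\mathcal S(t)=M_1(t)-M_2(t)$, where $M_1$ and $M_2$ are independent GCPs with rates $\lambda_1,\dots,\lambda_k$ and $\mu_1,\dots,\mu_k$, respectively. For $0<\alpha<1$, the stable subordinator $\{D_\alpha(t)\}_{t\ge0}$ is the non-decreasing Lévy process with $\mathbb E(e^{-sD_\alpha(t)})=e^{-ts^\alpha}$, $s>0$, and the inverse stable subordinator is $Y_\alpha(t)=\inf\{x\ge0:D_\alpha(x)>t\}$. The generalized fractional Skellam process (GFSP) is $\mathcal S^\alpha(t)=\mathcal S(Y_\alpha(t))$ for $0<\alpha<1$, with $\mathcal S$ independent of $Y_\alpha$, and $\mathcal S^1(t)=\mathcal S(t)$. LRD property: let $s>0$ be fixed and let $\{X(t)\}_{t\ge0}$ be a stochastic process such that $\operatorname{Corr}(X(s),X(t))\sim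 c(s)t^{-\gamma}$ as $t\to\infty$ for some $c(s)>0$. The process has the LRD property if $\gamma\in(0,1)$. *)

(* Defs.v *)
From HB Require Import structures.
From mathcomp Require Import all_boot all_order all_algebra.
From mathcomp Require Import all_classical all_reals all_analysis.

Set Implicit Arguments.
Unset Strict Implicit.
Unset Printing Implicit Defensive.

Import Order.TTheory GRing.Theory Num.Theory.
Import numFieldNormedType.Exports.

Local Open Scope classical_set_scope.
Local Open Scope ring_scope.

(* A process indexed by [0, +oo[ is a function X : R -> T -> R (time first);
   its values at negative times are never used. *)

Section processes.
Context d (T : measurableType d) (R : realType) (P : probability T R).
Implicit Types X Y S M N D : R -> T -> R.

Definition stochastic_process X :=
  forall t, 0 <= t -> measurable_fun [set: T] (X t).

Definition sigma_of (f : T -> R) : set (set T) :=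
  preimage_set_system [set: T] f measurable.

Definition sigma_of_process X : set (set T) :=
  <<s \bigcup_(t in [set t : R | 0 <= t]) sigma_of (X t) >>.

Definition mutually_independent (I : finType) (F : I -> set (set T)) :=
  forall (J : {set I}) (A : I -> set T), (forall i, i \in J -> F i (A i)) ->
  P (\bigcap_(i in [set` J]) A i) = (\prod_(i in J) P (A i))%E.

Definition independent_processes X Y :=
  forall A B, sigma_of_process X A -> sigma_of_process Y B ->
  P (A `&` B) = (P A * P B)%E.

Definition mutually_independent_processes (I : finType) (X : I -> R -> T -> R) :=
  mutually_independent (fun i => sigma_of_process (X i)).

Definition independent_increments X :=
  forall (n : nat) (t : nat -> R), 0 <= t 0%N ->
  {homo t : i j / (i <= j)%N >-> i <= j} ->
  mutually_independent (fun i : 'I_n => sigma_of (X (t i.+1) \- X (t i))).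

Definition stationary_increments X :=
  forall s h : R, 0 <= s -> 0 <= h ->
  forall B : set R, measurable B ->
  P ((X (s + h) \- X s) @^-1` B) = P (X h @^-1` B).

Definition nondecreasing_paths X :=
  forall w (s t : R), 0 <= s -> s <= t -> X s w <= X t w.

Definition right_continuous_paths X :=
  forall w (t : R), 0 <= t -> X u w @[u --> t^'+] --> X t w.

Definition left_limit_paths X :=
  forall w (t : R), 0 < t -> cvg (X u w @[u --> t^'-]).

Definition counting_process N :=
  [/\ stochastic_process N,
      forall w, N 0 w = 0,
      forall t w, 0 <= t -> N t w \is a Num.nat,
      nondecreasing_paths N &
      right_continuous_paths N].

Definition poisson_process (rate : R) N :=
  [/\ counting_process N,
      independent_increments N &
      forall (s t : R) (n : nat), 0 <= s -> s < t ->
        P [set w | N t w - N s w = n%:R]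
        = (poisson_pmf (rate * (t - s)) n)%:E].

(* The number of jumps of amplitude j made by M up to time t is N_j t; the index
   j : 'I_k starts at 0, hence the amplitude j.+1.  The equality is only almost
   sure, so that M may be any counting process with the law of the sum. *)
Definition generalized_counting_process (k : nat) (lambda : 'I_k -> R) M :=
  counting_process M /\
  exists N : 'I_k -> R -> T -> R,
    [/\ forall j, poisson_process (lambda j) (N j),
        mutually_independent_processes N &
        forall t, 0 <= t ->
          {ae P, forall w, M t w = \sum_(j < k) j.+1%:R * N j t w}].

Definition generalized_skellam_process (k : nat) (lambda mu : 'I_k -> R) S :=
  exists M1 M2,
    [/\ generalized_counting_process lambda M1,
        generalized_counting_process mu M2,
        independent_processes M1 M2 &
        forall t w, 0 <= t -> S t w = M1 t w - M2 t w].

Definition levy_process X :=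
  [/\ stochastic_process X,
      {ae P, forall w, X 0 w = 0},
      independent_increments X,
      stationary_increments X &
      right_continuous_paths X /\ left_limit_paths X].

Definition stable_subordinator (alpha : R) D :=
  [/\ levy_process D,
      nondecreasing_paths D &
      forall s t : R, 0 < s -> 0 <= t ->
        ('E_P[fun w => expR (- (s * D t w))%R])%E
        = (expR (- (t * s `^ alpha)))%:E].

(* On the paths along which D never exceeds t (a null event when D is a stable
   subordinator) the set is empty and its infimum is 0. *)
Definition inverse_process D : R -> T -> R :=
  fun t w => inf [set x : R | 0 <= x /\ t < D x w].

Definition generalized_fractional_skellam_process (k : nat) (alpha : R)
    (lambda mu : 'I_k -> R) X :=
  exists2 S, generalized_skellam_process lambda mu S &
    if alpha == 1 then forall t w, 0 <= t -> X t w = S t w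
    else exists D,
      [/\ stable_subordinator alpha D,
          independent_processes S (inverse_process D) &
          forall t w, 0 <= t -> X t w = S (inverse_process D t w) w].

Definition correlation (f g : T -> R) : R :=
  fine (covariance P f g) /
  (Num.sqrt (fine 'V_P[f]%E) * Num.sqrt (fine 'V_P[g]%E)).

(* Square integrability makes the correlations meaningful; the exponent gamma
   does not depend on s. *)
Definition LRD X :=
  (forall t, 0 <= t -> X t \in Lfun P 2%:E) /\
  exists gamma : R, 0 < gamma < 1 /\
    forall s : R, 0 < s -> exists c : R, 0 < c /\
      correlation (X s) (X t) / (c * t `^ (- gamma)) @[t --> +oo] --> (1 : R).

End processes.

(* Main.v *)
Require Import Defs.
From HB Require Import structures.
From mathcomp Require Import all_boot all_order all_algebra.
From mathcomp Require Import all_classical all_reals all_analysis.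
From mathcomp Require Import measurable_realfun ring lra.

Set Implicit Arguments.
Unset Strict Implicit.
Unset Printing Implicit Defensive.

Import Order.TTheory GRing.Theory Num.Theory.
Import numFieldNormedType.Exports.

Local Open Scope classical_set_scope.
Local Open Scope ring_scope.

(** Only the first two moments of a generalized Skellam process S enter. Since
S is a finite combination of independent Poisson processes,
  E S_u = m u,   E (S_u S_v) = V min(u, v) + m^2 u v,
with m = sum_j j (lambda_j - mu_j) and V = sum_j j^2 (lambda_j + mu_j) > 0
([gsp_levy_moments]). Without time change, Corr(S_s, S_t) = sqrt(s / t) for
s <= t: the exponent is 1/2.

For alpha < 1 write Y for the inverse subordinator, independent of S, and X for
the time-changed process. Integrating the formulas above over the law of Y
([subordinated_mean2]) gives
  Cov(X_s, X_t) = V E Y_s + m^2 Cov(Y_s, Y_t)  for s <= t,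
  Var X_t = V E Y_t + m^2 Var Y_t.
It remains to control Y ([inverse_subordinator_moments]). As Y_t is the time
that the subordinator D spends in [0, t], Tonelli's theorem turns E Y_t into the
integral of P(D_x <= t) over x >= 0, and E (Y_s Y_t) into the double integral of
P(D_x <= s, D_y <= t). Two properties of D then suffice.

- Self-similarity. A Laplace transform determines the law of a nonnegative
  variable ([laplace_tail]), so D_x / t and D_(x / t^alpha) have the same law.
  Rescaling the integrals gives E Y_t = u t^alpha and E Y_t^2 = q t^(2 alpha).
  Moreover q > u^2, that is, Y_1 is not almost surely constant: otherwise D_x
  would be bounded by 1 for some x > 0, whence exp(- x s^alpha) >= exp(- s) for
  all s > 0, which fails for small s as alpha < 1.
- Independent increments. For x < y they bracket P(D_x <= s, D_y <= t) between
  P(D_x <= s) P(D_(y-x) <= t - s) and P(D_x <= s) P(D_(y-x) <= t), while for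
  y <= x this probability is P(D_x <= s). With a(s) the integral of
  x P(D_x <= s), integration gives
    a(s) + E Y_s E Y_(t-s) <= E (Y_s Y_t) <= a(s) + E Y_s E Y_t.
  As t^alpha - (t - s)^alpha tends to 0, Cov(Y_s, Y_t) tends to a(s) > 0.

Thus Cov(X_s, X_t) has a positive limit as t grows, while Var X_t is equivalent
to a constant times t^(2 alpha) if m is nonzero, and times t^alpha if m = 0. The
correlation decays with exponent alpha in the first case and alpha / 2 in the
second ([LRD_of_covariance_limit]), and both lie in ]0, 1[. *)

Lemma mem_set_bool (T : Type) (p : pred T) x : (x \in [set y | p y]) = p x.
Proof. by apply/idP/idP; rewrite inE. Qed.

(** * Means *)
Section mean.
Context d (T : measurableType d) (R : realType) (P : probability T R).
Implicit Types (f g : T -> R) (a b : R).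

(** A relation rather than a value of the expectation operator: integrability
and the value of the mean are always established together. *)
Definition has_mean f a :=
  P.-integrable [set: T] (EFin \o f) /\ (\int[P]_w (f w)%:E = a%:E)%E.

Lemma has_mean_cst a : has_mean (fun=> a) a.
Proof.
split; last by rewrite integral_cst//= probability_setT mule1.
exact: finite_measure_integrable_cst.
Qed.

Lemma has_meanD f g a b : has_mean f a -> has_mean g b ->
  has_mean (fun w => f w + g w) (a + b).
Proof.
move=> [If Ef] [Ig Eg]; split; first exact: (integrableD measurableT If Ig).
by rewrite (integralD measurableT If Ig) Ef Eg.
Qed.

Lemma has_meanZ f a c : has_mean f a -> has_mean (fun w => c * f w) (c * a).
Proof.
move=> [If Ef]; split; first exact: (integrableZl measurableT c If).
by rewrite (integralZl measurableT If) Ef.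
Qed.

Lemma has_meanB f g a b : has_mean f a -> has_mean g b ->
  has_mean (fun w => f w - g w) (a - b).
Proof.
move=> hf /(has_meanZ (-1)) hg; have := has_meanD hf hg.
by rewrite mulN1r; under eq_fun do rewrite mulN1r.
Qed.

Lemma eq_has_mean f g a b : f =1 g -> a = b -> has_mean f a -> has_mean g b.
Proof. by move=> /funext -> ->. Qed.

Lemma has_mean_sum (I : Type) (s : seq I) (F : I -> T -> R) (a : I -> R) :
  (forall i, has_mean (F i) (a i)) ->
  has_mean (fun w => \sum_(i <- s) F i w) (\sum_(i <- s) a i).
Proof.
move=> h; elim: s => [|i s IH].
  by rewrite big_nil; under eq_fun do rewrite big_nil; exact: has_mean_cst.
by rewrite big_cons; under eq_fun do rewrite big_cons; exact: has_meanD.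
Qed.

Lemma has_mean_measurable f a : has_mean f a -> measurable_fun [set: T] f.
Proof. by move=> [/measurable_int/measurable_EFinP]. Qed.

Lemma has_mean_ae f g a : measurable_fun [set: T] g ->
  {ae P, forall w, f w = g w} -> has_mean f a -> has_mean g a.
Proof.
move=> mg fg [If Ef].
have mf := measurable_int _ If.
have h : (EFin \o f) = (EFin \o g) %[ae P in setT].
  by apply: filterS fg => w /= ->.
split; last by rewrite -Ef; apply: ae_eq_integral => //;
  [exact/measurable_EFinP|exact: ae_eq_sym].
apply/integrableP; split; first exact/measurable_EFinP.
have /integrableP[_] := If; congr (_ < _)%E.
apply: ae_eq_integral => //.
- exact: measurableT_comp.
- by apply: measurableT_comp => //; exact/measurable_EFinP.
- by apply: filterS fg => w /= -> _.
Qed.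

(** For a nonnegative function a finite value of the integral is already
integrability, so that Tonelli-type computations produce means directly. *)
Lemma has_mean_ge0 f a : measurable_fun [set: T] f -> (forall w, 0 <= f w) ->
  (\int[P]_w (f w)%:E = a%:E)%E -> has_mean f a.
Proof.
move=> mf f0 Ef; split=> //; apply/integrableP; split.
  exact/measurable_EFinP.
under eq_integral do rewrite /= ger0_norm//.
by rewrite Ef ltry.
Qed.

Lemma has_mean_le f g a b : (forall w, f w <= g w) ->
  has_mean f a -> has_mean g b -> a <= b.
Proof.
move=> fg [If Ef] [Ig Eg]; rewrite -lee_fin -Ef -Eg.
by apply: le_integral => // w _ /=; rewrite lee_fin.
Qed.

Lemma has_mean_expectation f a : has_mean f a -> ('E_P[f] = a%:E)%E.
Proof. by move=> [_ h]; rewrite unlock. Qed.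

Lemma has_mean_Lfun1 f a : has_mean f a -> f \in Lfun P 1.
Proof. by move=> [h _]; apply/Lfun1_integrable. Qed.

Lemma has_mean_sqr_Lfun2 f a : measurable_fun [set: T] f ->
  has_mean (fun w => f w ^+ 2) a -> f \in Lfun P 2%:E.
Proof.
move=> mf [If _]; rewrite inE; apply/andP; split; rewrite inE//=.
rewrite /finite_norm unlock /=; apply: poweR_lty.
move: If => /integrableP[_]; apply: le_lt_trans.
rewrite le_eqVlt; apply/orP; left; apply/eqP; apply: eq_integral => w _ /=.
by rewrite powR_mulrn// normrX.
Qed.

End mean.

(** * Expectations under independence *)

Section independence.
Context d d1 d2 (T : measurableType d) (T1 : measurableType d1)
  (T2 : measurableType d2) (R : realType) (P : probability T R).
Variables (f : T -> T1) (g : T -> T2).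
Hypotheses (mf : measurable_fun [set: T] f) (mg : measurable_fun [set: T] g).
Hypothesis fg : forall A B, measurable A -> measurable B ->
  P (f @^-1` A `&` g @^-1` B) = (P (f @^-1` A) * P (g @^-1` B))%E.

Let mfg : measurable_fun [set: T] (fun w => (f w, g w)).
Proof. exact: measurable_fun_pair. Qed.

Let f' : {mfun T >-> T1} := HB.pack f (isMeasurableFun.Build _ _ _ _ f mf).
Let g' : {mfun T >-> T2} := HB.pack g (isMeasurableFun.Build _ _ _ _ g mg).
Let fg' : {mfun T >-> (T1 * T2)%type} :=
  HB.pack (fun w => (f w, g w)) (isMeasurableFun.Build _ _ _ _ _ mfg).

(* Independence says that the two measures agree on measurable rectangles. *)
Let joint_law (A : set (T1 * T2)) : measurable A ->
  (distribution P f' \x distribution P g')%E A = distribution P fg' A.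
Proof.
by apply: product_measure_unique => A1 A2 mA mB; rewrite /distribution /pushforward /= -fg.
Qed.

Lemma independent_tonelli (h : T1 * T2 -> \bar R) :
  measurable_fun [set: T1 * T2] h -> (forall x, 0 <= h x)%E ->
  (\int[P]_w h (f w, g w) = \int[P]_v \int[P]_w h (f w, g v))%E.
Proof.
move=> mh h0.
rewrite -[LHS](@ge0_integral_distribution _ _ _ _ _ P fg' h)//.
rewrite -(eq_measure_integral _ (fun A mA _ => joint_law mA)).
rewrite fubini_tonelli2// ge0_integral_distribution//; last 2 first.
- exact: measurable_fun_fubini_tonelli_G.
- by move=> y; apply: integral_ge0.
apply: eq_integral => v _; rewrite /= /fubini_G/=.
rewrite (@ge0_integral_distribution _ _ _ _ _ P f' (fun x => h (x, g v)))//.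
exact: measurableT_comp.
Qed.

(** The mean is computed by freezing the second variable and averaging the
conditional means [phi]. Integrability comes from the conditional bound [psi] on
the absolute value, so that no integrability on the product space has to be
known beforehand. *)
Lemma independent_has_mean (h : T1 * T2 -> R) (phi psi : T -> R) a b :
  measurable_fun [set: T1 * T2] h ->
  (forall v, has_mean P (fun w => h (f w, g v)) (phi v)) ->
  (forall v, (\int[P]_w `|h (f w, g v)|%:E <= (psi v)%:E)%E) ->
  has_mean P phi a -> has_mean P psi b ->
  has_mean P (fun w => h (f w, g w)) a.
Proof.
move=> mh hphi hpsi [Iphi Ephi] [Ipsi Epsi].
have mh' : measurable_fun [set: T1 * T2] (EFin \o h) by exact/measurable_EFinP.
have lt1 : (\int[P]_v \int[P]_w `|h (f w, g v)|%:E < +oo)%E.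
  apply: (@le_lt_trans _ _ (\int[P]_v (psi v)%:E)%E); last by rewrite Epsi ltry.
  apply: ge0_le_integral => //.
  - by move=> v _; exact: integral_ge0.
  - apply: (@measurable_fun_fubini_tonelli_G _ _ _ _ _ P
      (fun x : T * T => `|h (f x.1, g x.2)|%:E)) => //.
    apply/measurable_EFinP; do 2 apply: measurableT_comp => //.
    by apply: measurable_fun_pair; exact: measurableT_comp.
  - exact: measurable_int Ipsi.
have Ifg : P.-integrable [set: T] (EFin \o (fun w => h (f w, g w))).
  apply/integrableP; split; first by apply/measurable_EFinP; exact: measurableT_comp.
  rewrite (independent_tonelli (h := fun x => `|h x|%:E))//.
  by apply: measurableT_comp => //; exact: measurableT_comp.
split => //.
rewrite -[LHS](@integral_distribution _ _ _ _ _ P fg' (EFin \o h))//.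
rewrite -(eq_measure_integral _ (fun A mA _ => joint_law mA)).
have Ip : (distribution P f' \x distribution P g')%E.-integrable setT (EFin \o h).
  apply/integrable21ltyP => //.
  rewrite (ge0_integral_distribution g'); last 2 first.
  - apply: (@measurable_fun_fubini_tonelli_G _ _ _ _ _ (distribution P f')
      (abse \o (EFin \o h))) => [|x]; last exact: abse_ge0.
    exact: measurableT_comp.
  - by move=> y; exact: integral_ge0.
  under eq_integral => v _.
    rewrite /= (@ge0_integral_distribution _ _ _ _ _ P f' (fun x => `|h (x, g v)|%:E))//; last first.
      by apply: measurableT_comp => //; apply: measurableT_comp => //;
      exact: measurableT_comp.
    over.
  exact: lt1.
rewrite -integral21_prod_meas1//.
have Eg v : (fubini_G (distribution P f') (EFin \o h) (g v) = (phi v)%:E)%E.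
  rewrite /fubini_G (@integral_distribution _ _ _ _ _ P f' (fun x => (h (x, g v))%:E)).
  - by have [_ <-] := hphi v.
  - by apply/measurable_EFinP; exact: measurableT_comp.
  - by have [] := hphi v.
rewrite (@integral_distribution _ _ _ _ _ P g').
- by rewrite -Ephi; apply: eq_integral => v _; rewrite -Eg.
- exact: measurable_fubini_G Ip.
- rewrite (_ : _ \o _ = EFin \o phi)//.
  by apply/funext => v; rewrite /= -Eg.
Qed.

End independence.

(** * Affine changes of variable *)
Section lebesgue_affine.
Context (R : realType).
Local Notation lambda := (@lebesgue_measure R).

(* The type constraint selects the Borel sigma-algebra on the codomain. *)
Let affine (a b x : R) : measurableTypeR R := a * x + b.

Let measurable_affine a b : measurable_fun [set: measurableTypeR R] (affine a b).
Proof. by apply: measurable_funD => //; exact: measurable_funM. Qed.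

Lemma lebesgue_measure_affine (a b : R) (A : set R) : 0 < a -> measurable A ->
  lambda A = (a%:E * lambda ((fun x => a * x + b)%R @^-1` A))%E.
Proof.
move=> a0 mA.
pose image : {measure set (measurableTypeR R) -> \bar R} :=
  pushforward lambda (affine a b).
pose m := image (measurable_affine a b).
rewrite [LHS](@lebesgue_measure_unique _ (mscale (NngNum (ltW a0)) m))//.
move=> _ [[c e] _ <-] /=.
rewrite /mscale /= /pushforward /affine /=.
rewrite (_ : _ @^-1` _ = `](c - b) / a, (e - b) / a]%classic); last first.
  apply/seteqP; split => x /=; rewrite !in_itv/=;
    by rewrite ltr_pdivrMr// ler_pdivlMr// ltrBlDr lerBrDr mulrC.
rewrite !lebesgue_measure_itv/= !lte_fin ltr_pM2r ?invr_gt0//.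
rewrite ltrD2r; case: ifPn => ce; last by rewrite mule0.
by rewrite -!EFinD -EFinM; congr EFin; field; rewrite gt_eqF.
Qed.

Lemma integral_affine (a b : R) (D : set R) (f : R -> \bar R) : 0 < a ->
  measurable D -> measurable_fun D f -> (forall x, D x -> 0 <= f x)%E ->
  (\int[lambda]_(x in D) f x =
   a%:E * \int[lambda]_(x in (fun x => a * x + b)%R @^-1` D) f (a * x + b)%R)%E.
Proof.
move=> a0 mD mf f0.
pose image : {measure set (measurableTypeR R) -> \bar R} :=
  pushforward lambda (affine a b).
pose m := image (measurable_affine a b).
transitivity (\int[mscale (NngNum (ltW a0)) m]_(x in D) f x)%E.
  by apply: eq_measure_integral => A mA _; exact: lebesgue_measure_affine.
rewrite ge0_integral_mscale//; congr (_ * _)%E.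
rewrite ge0_integral_pushforward// => x; rewrite inE; exact: f0.
Qed.

End lebesgue_affine.

(** * Joint measurability of right-continuous processes *)
Section joint_measurability.
Context d (T : measurableType d) (R : realType).

(* The first multiple of 1 / (n + 1) that exceeds max(u, 0). Being strict, it is
approached from the right, where right-continuity applies. *)
Let grid (n : nat) (u : R) : R := (Num.truncn (n.+1%:R * u)).+1%:R / n.+1%:R.

Let grid_gt n u : Num.max u 0 < grid n u.
Proof.
rewrite gt_max; apply/andP; split; last by rewrite divr_gt0.
by rewrite ltr_pdivlMr// mulrC truncnS_gt.
Qed.

Let grid_le n u : grid n u <= Num.max u 0 + n.+1%:R^-1.
Proof.
rewrite /grid -natr1 mulrDl mul1r lerD2r ler_pdivrMr//.
have [u0|u0] := leP 0 u.
  by rewrite mulrC truncn_le mulr_ge0.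
rewrite mul0r.
suff /truncn0Pn -> : ~~ (1 <= n.+1%:R * u) by [].
by rewrite -ltNge (lt_trans _ (@ltr01 R))// pmulr_rlt0.
Qed.

Let grid_cvg u : grid n u @[n --> \oo] --> Num.max u 0.
Proof.
apply: (@squeeze_cvgr _ _ _ _ (fun=> Num.max u 0) (fun n => Num.max u 0 + n.+1%:R^-1)).
- by apply: nearW => n; rewrite grid_le ltW.
- exact: cvg_cst.
- rewrite -[X in _ --> X]addr0; apply: cvgD; first exact: cvg_cst.
  exact: cvg_harmonic.
Qed.

(** The process is the limit of its values on the grids, each of which is a
countable superposition of products of a path event and an interval of times.
Negative times are sent to 0, which gives a function of all real times. *)
Lemma measurable_right_continuous_process (X : R -> T -> R) :
  (forall t, 0 <= t -> measurable_fun [set: T] (X t)) ->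
  (forall w t, 0 <= t -> X u w @[u --> t^'+] --> X t w) ->
  measurable_fun [set: T * R] (fun p => X (Num.max p.2 0) p.1).
Proof.
move=> mX rcX.
apply: (@measurable_fun_cvg _ _ _ _ (fun n p => X (grid n p.2) p.1)).
- move=> n _ B mB; rewrite setTI.
  rewrite (_ : _ @^-1` B = \bigcup_k
      ((X (k.+1%:R / n.+1%:R) @^-1` B) `*`
       ((fun u : R => Num.truncn (n.+1%:R * u)) @^-1` [set k]))); last first.
    apply/seteqP; split => [[w u] /= Bu|[w u] [k _ [/= Bk ku]]].
    2: by rewrite /= /grid ku.
    by exists (Num.truncn (n.+1%:R * u)).
  apply: bigcup_measurable => k _; apply: measurableX.
    by rewrite -[X in measurable X]setTI; apply: mX => //; rewrite divr_ge0.
  apply: is_interval_measurable => x y /= hx hy z /andP[xz zy].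
  apply/eqP; rewrite eqn_leq; apply/andP; split; [rewrite -hy|rewrite -hx];
    by apply: le_truncn; rewrite ler_pM2l.
- move=> [w u] _ /=.
  have /cvg_at_rightP := rcX w (Num.max u 0) (ltac:(by rewrite le_max lexx orbT)).
  by apply; split => [n|]; [exact: grid_gt|exact: grid_cvg].
Qed.

End joint_measurability.

(** * Second-order structure of generalized Skellam processes *)
Section poisson_moments.
Context d (T : measurableType d) (R : realType) (P : probability T R).
Variables (N : T -> R) (r : R).
Hypotheses (mN : measurable_fun [set: T] N)
  (natN : forall w, N w \is a Num.nat) (r_gt0 : 0 < r)
  (lawN : forall n : nat, P [set w | N w = n%:R] = (poisson_pmf r n)%:E).

Let p n : R := poisson_pmf r n.

Let p_ge0 n : 0 <= p n. Proof. exact: poisson_pmf_ge0. Qed.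

Let integral_law (f : R -> R) : (forall n : nat, 0 <= f n%:R) ->
  measurable_fun [set: R] f ->
  (\int[P]_w (f (N w))%:E = \sum_(0 <= n <oo) (f n%:R * p n)%:E)%E.
Proof.
move=> f0 mf.
have mfib n : measurable [set w | N w = n%:R].
  by have := mN measurableT (measurable_set1 (n%:R : R)); rewrite setTI.
have cover : \bigcup_n [set w | N w = n%:R] = [set: T].
  apply/seteqP; split => // w _; have /natrP[n Nn] := natN w.
  by exists n.
rewrite -cover ge0_integral_bigcup//=.
- apply: eq_eseriesr => n _.
  rewrite (eq_integral (cst (f n%:R)%:E)); last by move=> w; rewrite inE/= => ->.
  by rewrite integral_cst//= lawN EFinM.
- by rewrite cover; apply/measurable_EFinP; exact: measurableT_comp.
- by move=> w [n _ /= ->]; rewrite lee_fin.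
- by move=> i j _ _ [w [/= -> /eqP]]; rewrite eqr_nat => /eqP.
Qed.

(* The probabilities of the law of [N] add up to 1, which spares summing the
exponential series. *)
Let sum_p : (\sum_(0 <= n <oo) (p n)%:E = 1)%E.
Proof.
rewrite -(probability_setT P) -[RHS]mul1e -integral_cst//.
rewrite (@integral_law (cst 1))//.
by apply: eq_eseriesr => n _; rewrite mul1r.
Qed.

(* This recurrence reduces each moment to the preceding ones by shifting the
index of summation. *)
Let pS n : n.+1%:R * p n.+1 = r * p n.
Proof.
rewrite /p /poisson_pmf r_gt0 exprS factS natrM invfM.
field.
by rewrite addrC natr1 !pnatr_eq0 -lt0n fact_gt0.
Qed.

Let shift (f : nat -> R) : (forall n, 0 <= f n) -> f 0%N = 0 ->
  (\sum_(0 <= n <oo) (f n)%:E = \sum_(0 <= n <oo) (f n.+1)%:E)%E.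
Proof.
move=> f0 f00; rewrite nneseries_recl//; last by move=> n _; rewrite lee_fin.
rewrite f00 add0e.
rewrite -(@nneseries_addn _ (EFin \o f) 1)//.
by apply: eq_eseriesr => n _; rewrite /= addn1.
Qed.

Let mean_p : (\sum_(0 <= n <oo) (n%:R * p n)%:E = r%:E)%E.
Proof.
rewrite shift => [|n|]; [|by rewrite mulr_ge0|by rewrite mul0r].
under eq_eseriesr do rewrite pS EFinM.
by rewrite nneseriesZl ?sum_p ?mule1// => n _; rewrite lee_fin.
Qed.

Lemma poisson_mean : has_mean P N r.
Proof.
apply: has_mean_ge0 => //.
  by move=> w; have /natrP[n ->] := natN w.
by rewrite (@integral_law id)//; exact: mean_p.
Qed.

Lemma poisson_mean_sqr : has_mean P (fun w => N w ^+ 2) (r + r ^+ 2).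
Proof.
apply: has_mean_ge0; [exact: measurable_funX|by move=> w; exact: sqr_ge0|].
rewrite (@integral_law (fun x => x ^+ 2))//.
rewrite shift => [|n|]; [|by rewrite mulr_ge0 ?sqr_ge0|by rewrite expr0n mul0r].
under eq_eseriesr => n _.
  (* (n + 1)^2 p(n + 1) = (n + 1) r p(n). *)
  rewrite (_ : _ * _ = r * (n%:R * p n) + r * p n); last first.
    by rewrite expr2 -mulrA pS -natr1; ring.
  rewrite EFinD !(EFinM r); over.
rewrite nneseriesD; last 2 first.
- by move=> n _ _; rewrite -EFinM lee_fin !mulr_ge0// ltW.
- by move=> n _ _; rewrite -EFinM lee_fin !mulr_ge0// ltW.
rewrite !nneseriesZl ?sum_p ?mean_p ?mule1; first by rewrite -EFinM -EFinD addrC expr2.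
- by move=> n _; rewrite lee_fin.
- by move=> n _; rewrite lee_fin mulr_ge0.
Qed.

End poisson_moments.

Section levy_moments.
Context d (T : measurableType d) (R : realType) (P : probability T R).
Implicit Types (Z N M S : R -> T -> R).

(** The first two moments of a Levy process whose value at time 1 has mean [m]
and variance [V]. *)
Definition levy_moments (m V : R) Z := forall u v : R, 0 <= u -> 0 <= v ->
  has_mean P (Z u) (m * u) /\
  has_mean P (fun w => Z u w * Z v w) (V * Num.min u v + m ^+ 2 * (u * v)).

Lemma has_meanM_independent (f g : T -> R) a b :
  (forall w, 0 <= f w) -> (forall w, 0 <= g w) ->
  (forall A B, measurable A -> measurable B ->
    P (f @^-1` A `&` g @^-1` B) = P (f @^-1` A) * P (g @^-1` B))%E ->
  has_mean P f a -> has_mean P g b -> has_mean P (fun w => f w * g w) (a * b).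
Proof.
move=> f0 g0 fg hf hg.
have mf := has_mean_measurable hf; have mg := has_mean_measurable hg.
apply: has_mean_ge0; [exact: measurable_funM|by move=> w; rewrite mulr_ge0|].
have -> : (\int[P]_w (f w * g w)%:E =
    \int[P]_w ((Num.norm \o (fun x : R * R => x.1 * x.2)) (f w, g w))%:E)%E.
  by apply: eq_integral => w _ /=; rewrite ger0_norm ?mulr_ge0.
rewrite (@independent_tonelli _ _ _ _ _ _ _ P _ _ mf mg fg
  (EFin \o (Num.norm \o (fun x : R * R => x.1 * x.2)))); last 2 first.
- by apply/measurable_EFinP; apply: measurableT_comp => //; exact: measurable_funM.
- by move=> x; rewrite /= lee_fin normr_ge0.
have [_ <-] := has_meanZ a hg.
apply: eq_integral => v _ /=.
rewrite mulrC; have [_ <-] := has_meanZ (g v) hf.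
by apply: eq_integral => w _ /=; rewrite ger0_norm ?mulr_ge0// mulrC.
Qed.

Lemma mutually_independent_pair (I : finType) (F : I -> set (set T)) i j A B :
  mutually_independent P F -> i != j -> F i A -> F j B ->
  P (A `&` B) = (P A * P B)%E.
Proof.
move=> indF ij FA FB.
have := indF [set i; j]%SET (fun l => if l == i then A else B).
rewrite big_setU1 ?inE//= big_set1 eqxx [j == i]eq_sym (negbTE ij) => <-.
  congr (P _); apply/seteqP; split => [w [Aw Bw] l /=|w /= h].
    by rewrite !inE => /orP[] /eqP ->; rewrite ?eqxx// eq_sym (negbTE ij).
  split; first by have := h i; rewrite /= !inE !eqxx; apply.
  by have := h j; rewrite /= !inE eqxx orbT eq_sym (negbTE ij); apply.
by move=> l; rewrite !inE => /orP[] /eqP ->; rewrite ?eqxx// eq_sym (negbTE ij).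
Qed.

Lemma independent_increments_pair Z (s t : R) (A B : set R) :
  independent_increments P Z -> 0 <= s -> s <= t -> measurable A -> measurable B ->
  P ((Z s \- Z 0) @^-1` A `&` (Z t \- Z s) @^-1` B) =
  (P ((Z s \- Z 0)%R @^-1` A) * P ((Z t \- Z s)%R @^-1` B))%E.
Proof.
move=> indZ s0 st mA mB.
pose times (n : nat) : R := if n is n'.+1 then (if n' is 0 then s else t) else 0.
have ind : mutually_independent P
    (fun i : 'I_2 => sigma_of (Z (times i.+1) \- Z (times i))).
  by apply: indZ => // -[|[|i]] [|[|j]] //=; rewrite ?lexx// => _; exact: le_trans st.
apply: (mutually_independent_pair (i := ord0) (j := ord_max) ind) => //.
- by exists A => //; rewrite setTI.
- by exists B => //; rewrite setTI.
Qed.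

Lemma sigma_of_processP Z (t : R) (A : set R) : 0 <= t -> measurable A ->
  sigma_of_process Z (Z t @^-1` A).
Proof.
move=> t0 mA; apply: sub_sigma_algebra; exists t => //.
by exists A => //; rewrite setTI.
Qed.

(** For u <= v, N_u N_v = N_u^2 + N_u (N_v - N_u), and the two factors of the
last product are independent and nonnegative. *)
Lemma poisson_levy_moments (rate : R) N : 0 < rate -> poisson_process P rate N ->
  levy_moments rate rate N.
Proof.
move=> rate0 [[mN N0 natN ndN rcN] indN lawN].
have N_ge0 (t : R) w : 0 <= t -> 0 <= N t w.
  by move=> t0; have /natrP[n ->] := natN t w t0.
have pos (t : R) : 0 < t -> has_mean P (N t) (rate * t) /\
    has_mean P (fun w => N t w ^+ 2) (rate * t + (rate * t) ^+ 2).
  move=> t0.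
  have law n : P [set w | N t w = n%:R] = (poisson_pmf (rate * t) n)%:E.
    rewrite -[X in rate * X]subr0 -lawN//; congr (P _).
    by apply/seteqP; split => w /=; rewrite N0 subr0.
  have rt0 : 0 < rate * t by rewrite mulr_gt0.
  by split; [apply: poisson_mean|apply: poisson_mean_sqr] => //;
    do ?[exact/mN/ltW|by move=> w; exact/natN/ltW].
have one (t : R) : 0 <= t -> has_mean P (N t) (rate * t) /\
    has_mean P (fun w => N t w ^+ 2) (rate * t + (rate * t) ^+ 2).
  rewrite le_eqVlt => /predU1P[<-|]; last exact: pos.
  have -> : N 0 = fun=> 0 by apply/funext => w.
  by rewrite !mulr0 expr0n/= addr0; split; exact: has_mean_cst.
have two (u v : R) : 0 <= u -> u <= v ->
    has_mean P (fun w => N u w * N v w) (rate * u + rate ^+ 2 * (u * v)).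
  move=> u0 uv; have v0 := le_trans u0 uv.
  have hinc := has_meanB (one v v0).1 (one u u0).1.
  have := has_meanD (one u u0).2 (has_meanM_independent _ _ _ (one u u0).1 hinc).
  move=> h; apply: (eq_has_mean _ _ (h _ _ _)) => [w||||].
  - by rewrite /=; ring.
  - by ring.
  - by move=> w; exact: N_ge0.
  - by move=> w; rewrite subr_ge0; exact: ndN.
  - move=> A B mA mB.
    have := independent_increments_pair indN u0 uv mA mB.
    by congr (P (_ `&` _) = P _ * _)%E; apply/seteqP; split => w /=;
      rewrite N0 subr0.
move=> u v u0 v0; split; first exact: (one u u0).1.
have [uv|/ltW vu] := leP u v; first exact: two.
by under eq_fun do rewrite mulrC; rewrite [u * v]mulrC; exact: two.
Qed.

Lemma levy_momentsZ (c m V : R) Z : levy_moments m V Z ->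
  levy_moments (c * m) (c ^+ 2 * V) (fun t w => c * Z t w).
Proof.
move=> hZ u v u0 v0; have [hu huv] := hZ u v u0 v0.
split; first by rewrite -mulrA; exact: has_meanZ.
have := has_meanZ (c ^+ 2) huv.
rewrite (_ : c ^+ 2 * _ = c ^+ 2 * V * Num.min u v + (c * m) ^+ 2 * (u * v)); last by ring.
by under eq_fun do rewrite expr2 mulrACA.
Qed.

(** The parameters add up for independent summands; only the product moments of
distinct summands are needed from independence. *)
Lemma levy_moments_sum (I : finType) (m V : I -> R) (Z : I -> R -> T -> R) :
  (forall i, levy_moments (m i) (V i) (Z i)) ->
  (forall i j (u v : R), i != j -> 0 <= u -> 0 <= v ->
    has_mean P (fun w => Z i u w * Z j v w) ((m i * u) * (m j * v))) ->
  levy_moments (\sum_i m i) (\sum_i V i) (fun t w => \sum_i Z i t w).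
Proof.
move=> hZ cross u v u0 v0; split.
  by rewrite mulr_suml; apply: has_mean_sum => i; have [] := hZ i u v u0 v0.
under eq_fun do rewrite mulr_suml.
under eq_fun do under eq_bigr do rewrite mulr_sumr.
rewrite (_ : _ + _ = \sum_i \sum_j ((m i * u) * (m j * v) +
   (if j == i then V i * Num.min u v else 0))); last first.
  under [RHS]eq_bigr => i _ do rewrite big_split/= -big_mkcond/= big_pred1_eq -mulr_sumr.
  rewrite big_split/= -!mulr_suml addrC; congr (_ + _).
  by rewrite expr2 mulrACA.
apply: has_mean_sum => i; apply: has_mean_sum => j.
case: eqP => [->|/eqP ji].
  have [_] := hZ i u v u0 v0.
  by rewrite addrC expr2 mulrACA.
by rewrite addr0; apply: cross; rewrite // eq_sym.
Qed.

Lemma levy_moments_ae (m V : R) Z Z' : levy_moments m V Z ->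
  (forall t : R, 0 <= t -> measurable_fun [set: T] (Z' t)) ->
  (forall t : R, 0 <= t -> {ae P, forall w, Z' t w = Z t w}) ->
  levy_moments m V Z'.
Proof.
move=> hZ mZ' ZZ' u v u0 v0; have [hu huv] := hZ u v u0 v0; split.
  apply: has_mean_ae hu; first exact: mZ'.
  by apply: filterS (ZZ' u u0) => w ->.
apply: has_mean_ae huv; first by apply: measurable_funM; exact: mZ'.
by apply: filterS2 (ZZ' u u0) (ZZ' v v0) => w -> ->.
Qed.

Lemma gcp_levy_moments k (lambda : 'I_k -> R) M :
  (forall j, 0 < lambda j) -> generalized_counting_process P lambda M ->
  levy_moments (\sum_(j < k) j.+1%:R * lambda j) (\sum_(j < k) j.+1%:R ^+ 2 * lambda j) M.
Proof.
move=> lambda0 [[mM _ _ _ _] [N [poisN indN MN]]].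
have hN j := poisson_levy_moments (lambda0 j) (poisN j).
apply: levy_moments_ae mM MN; apply: levy_moments_sum => [i|i j u v ij u0 v0].
  exact: levy_momentsZ.
have Npos l (t : R) w : 0 <= t -> 0 <= N l t w.
  by move=> t0; have [[_ _ natN _ _] _ _] := poisN l; have /natrP[n ->] := natN t w t0.
have := has_meanZ (i.+1%:R * j.+1%:R)
  (has_meanM_independent (fun w => Npos i u w u0) (fun w => Npos j v w v0) _
  (hN i u u u0 u0).1 (hN j v v v0 v0).1).
rewrite mulrACA !mulrA; under eq_fun do rewrite mulrACA.
apply=> A B mA mB; apply: (mutually_independent_pair indN ij);
  exact: sigma_of_processP.
Qed.

Lemma gsp_levy_moments k (lambda mu : 'I_k -> R) S :
  (forall j, 0 < lambda j) -> (forall j, 0 < mu j) ->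
  generalized_skellam_process P lambda mu S ->
  levy_moments (\sum_(j < k) j.+1%:R * (lambda j - mu j))
    (\sum_(j < k) j.+1%:R ^+ 2 * (lambda j + mu j)) S.
Proof.
move=> lambda0 mu0 [M1 [M2 [G1 G2 ind SM]]].
have h1 := gcp_levy_moments lambda0 G1; have h2 := gcp_levy_moments mu0 G2.
have -> : \sum_(j < k) j.+1%:R * (lambda j - mu j) =
    \sum_(j < k) j.+1%:R * lambda j - \sum_(j < k) j.+1%:R * mu j.
  by rewrite -sumrB; apply: eq_bigr => j _; rewrite mulrBr.
have -> : \sum_(j < k) j.+1%:R ^+ 2 * (lambda j + mu j) =
    \sum_(j < k) j.+1%:R ^+ 2 * lambda j + \sum_(j < k) j.+1%:R ^+ 2 * mu j.
  by rewrite -big_split; apply: eq_bigr => j _; rewrite mulrDr.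
set m1 := \sum_i _ in h1 *; set m2 := \sum_i _ * mu i in h2 *.
set V1 := \sum_i _ in h1 *; set V2 := \sum_i _ ^+ 2 * mu i in h2 *.
have cross (u v : R) : 0 <= u -> 0 <= v ->
    has_mean P (fun w => M1 u w * M2 v w) ((m1 * u) * (m2 * v)).
  move=> u0 v0; apply: has_meanM_independent (h1 u u u0 u0).1 (h2 v v v0 v0).1.
  - by move=> w; have [[_ _ natM _ _] _] := G1; have /natrP[n ->] := natM u w u0.
  - by move=> w; have [[_ _ natM _ _] _] := G2; have /natrP[n ->] := natM v w v0.
  - by move=> A B mA mB; apply: ind; exact: sigma_of_processP.
move=> u v u0 v0.
have Su : S u = fun w => M1 u w - M2 u w by apply/funext => w; exact: SM.
have Sv : S v = fun w => M1 v w - M2 v w by apply/funext => w; exact: SM.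
rewrite Su Sv; split.
  by rewrite mulrBl; apply: has_meanB; [exact: (h1 u u u0 u0).1|exact: (h2 u u u0 u0).1].
have := has_meanB (has_meanD (h1 u v u0 v0).2 (h2 u v u0 v0).2)
  (has_meanD (cross u v u0 v0) (cross v u v0 u0)).
rewrite (_ : _ - _ = (V1 + V2) * Num.min u v + (m1 - m2) ^+ 2 * (u * v)); last by ring.
congr has_mean; apply/funext => w; ring.
Qed.

End levy_moments.

(** * Uniqueness of Laplace transforms *)
Section laplace_uniqueness.
Context d (T : measurableType d) (R : realType) (P : probability T R).
Implicit Types (Z : T -> R) (t z q : R).

(* For z <> t the power (1 - exp(- (n+1) z))^K with K close to exp((n+1) t) is
near exp(- exp((n+1) (t - z))), which tends to 1 if z > t and to 0 if z < t. The
additional factor n+1 in K makes the limit 0 for z = t as well, so that an atom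
at t is harmless. *)
Let degree t n : nat := Num.truncn (n.+1%:R * expR (n.+1%:R * t)).

Let bernoulli q (N : nat) : 0 <= q <= 1 -> 1 - N%:R * q <= (1 - q) ^+ N.
Proof.
move=> /andP[q0 q1]; elim: N => [|N IH]; first by rewrite mul0r subr0 expr0.
rewrite exprS (le_trans _ (ler_wpM2l _ IH)) ?subr_ge0//.
rewrite -natr1 -subr_ge0 (_ : _ - _ = N%:R * q ^+ 2); last by ring.
by rewrite mulr_ge0 ?sqr_ge0.
Qed.

(* Bernoulli's inequality bounds the power from below if z > t; if z <= t it is
at most exp(- K exp(- (n+1) z)), hence at most 1 / (n+1). *)
Let indicator_limit t z : 0 <= z ->
  (1 - expR (- (n.+1%:R * z))) ^+ degree t n @[n --> \oo] --> ((t < z)%R%:R : R).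
Proof.
move=> z0.
have q01 n : 0 <= expR (- (n.+1%:R * z)) <= 1.
  by rewrite expR_ge0 -expR0 ler_expR oppr_le0 mulr_ge0.
have degree_le n : (degree t n)%:R <= n.+1%:R * expR (n.+1%:R * t).
  by rewrite truncn_le mulr_ge0// expR_ge0.
have [tz|zt] := ltP t z; rewrite /=.
- pose delta := z - t; have delta0 : 0 < delta by rewrite subr_gt0.
  apply: (@squeeze_cvgr _ _ _ _ (fun n => 1 - 4 / delta ^+ 2 * n.+1%:R^-1) (fun=> 1)).
  + apply: nearW => n; apply/andP; split; last first.
      by case/andP: (q01 n) => q0 q1; rewrite exprn_ile1 ?subr_ge0// gerBl.
    apply: le_trans (bernoulli (degree t n) (q01 n)); rewrite lerB//.
    rewrite (le_trans (ler_wpM2r (expR_ge0 _) (degree_le n)))//.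
    rewrite -(mulrA n.+1%:R) -expRD (_ : _ + - _ = - (n.+1%:R * delta)); last first.
      by rewrite /delta; ring.
    rewrite expRN ler_pdivrMr ?expR_gt0//.
    have n0 : (0 : R) < n.+1%:R by [].
    (* exp(y) >= y^2 / 4 absorbs the factor n+1 and leaves a term in 1 / (n+1). *)
    have e1 := expR_ge1Dx (n.+1%:R * delta / 2).
    have e2 : (n.+1%:R * delta / 2) ^+ 2 <= expR (n.+1%:R * delta).
      rewrite (_ : n.+1%:R * delta = n.+1%:R * delta / 2 + n.+1%:R * delta / 2); last by field.
      rewrite expRD -expr2; set y := _ / 2 in e1 *.
      have y0 : 0 <= y by rewrite divr_ge0// mulr_ge0// ltW.
      by rewrite -splitr -/y lerXn2r// ?nnegrE ?expR_ge0// (le_trans _ e1)// lerDr.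
    have c0 : 0 <= 4 / delta ^+ 2 / n.+1%:R.
      by rewrite !divr_ge0// exprn_ge0// ltW.
    apply: le_trans (ler_wpM2l c0 e2).
    rewrite le_eqVlt; apply/orP; left; apply/eqP; field.
    by rewrite addrC natr1 !gt_eqF.
  + rewrite -[X in _ --> X]subr0; apply: cvgB; first exact: cvg_cst.
    rewrite -[X in _ --> X](mulr0 (4 / delta ^+ 2)).
    by apply: cvgM; [exact: cvg_cst|exact: cvg_harmonic].
  + exact: cvg_cst.
- apply: (@squeeze_cvgr _ _ _ _ (fun=> 0) (fun n => n.+1%:R^-1)).
  + apply: nearW => n; case/andP: (q01 n) => q0 q1.
    rewrite exprn_ge0 ?subr_ge0//=.
    set q := expR (- _) in q0 q1 *.
    have qN : n.+1%:R <= 1 + q * (degree t n)%:R.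
      have : n.+1%:R * expR (n.+1%:R * t) < (degree t n)%:R + 1.
        by rewrite natr1; exact: truncnS_gt.
      move=> /ltW /(ler_wpM2l q0); rewrite mulrDr mulr1 mulrCA => h.
      have : n.+1%:R <= n.+1%:R * (q * expR (n.+1%:R * t)).
        rewrite ler_pMr// /q -expRD -[leLHS]expR0 ler_expR addrC subr_ge0.
        by rewrite ler_pM2l.
      move=> /le_trans /(_ h); rewrite addrC => /le_trans; apply.
      by rewrite lerD2r.
    apply: (@le_trans _ _ (expR (- (q * (degree t n)%:R)))).
      rewrite -mulNr mulrC expRM_natl lerXn2r ?nnegrE ?subr_ge0 ?expR_ge0//.
      exact: expR_ge1Dx.
    rewrite expRN lef_pV2 ?posrE ?expR_gt0//.
    by apply: le_trans qN _; exact: expR_ge1Dx.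
  + exact: cvg_cst.
  + exact: cvg_harmonic.
Qed.

(** The indicator of ]t, +oo[ is a bounded pointwise limit on [0, +oo[ of
polynomials in exp(- (n+1) z), whose means are determined by the values of the
Laplace transform at the positive integers. *)
Lemma laplace_tail Z Z' t : (forall w, 0 <= Z w) -> (forall w, 0 <= Z' w) ->
  (forall n : nat, exists a, has_mean P (fun w => expR (- (n.+1%:R * Z w))) a /\
    has_mean P (fun w => expR (- (n.+1%:R * Z' w))) a) ->
  P [set w | t < Z w] = P [set w | t < Z' w].
Proof.
move=> Z0 Z'0 laplaceE.
pose approx (Y : T -> R) n w := (1 - expR (- (n.+1%:R * Y w))) ^+ degree t n.
have approx_mean n : exists a, has_mean P (approx Z n) a /\ has_mean P (approx Z' n) a.
  have power i : exists a,
      has_mean P (fun w => expR (- (n.+1%:R * Z w)) ^+ i) a /\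
      has_mean P (fun w => expR (- (n.+1%:R * Z' w)) ^+ i) a.
    case: i => [|i]; first by exists 1; split; exact: has_mean_cst.
    have [a [h h']] := laplaceE (n.+1 * i.+1).-1%N.
    exists a; split; [apply: eq_has_mean h|apply: eq_has_mean h'] => // w;
      by rewrite prednK ?muln_gt0// -expRM_natl natrM; congr expR; ring.
  (* Choose common means c_i of the powers, then expand by the binomial formula. *)
  pose c i := xget 0 [set a |
      has_mean P (fun w => expR (- (n.+1%:R * Z w)) ^+ i) a /\
      has_mean P (fun w => expR (- (n.+1%:R * Z' w)) ^+ i) a].
  have hc i : has_mean P (fun w => expR (- (n.+1%:R * Z w)) ^+ i) (c i) /\
      has_mean P (fun w => expR (- (n.+1%:R * Z' w)) ^+ i) (c i).
    exact: (xgetPex 0 (power i)).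
  exists (\sum_(i < (degree t n).+1) ((-1) ^+ i * 'C(degree t n, i)%:R) * c i).
  have expand (Y : T -> R) : (forall i, has_mean P (fun w => expR (- (n.+1%:R * Y w)) ^+ i) (c i)) ->
      has_mean P (approx Y n)
        (\sum_(i < (degree t n).+1) ((-1) ^+ i * 'C(degree t n, i)%:R) * c i).
    move=> hY; apply: (@eq_has_mean _ _ _ _ _ _ _ _ _ erefl
      (has_mean_sum _ (fun i : 'I_(degree t n).+1 =>
         has_meanZ ((-1) ^+ i * 'C(degree t n, i)%:R) (hY i)))) => w.
    rewrite /approx exprBn; apply: eq_bigr => i _.
    by rewrite expr1n mulr1 mulrAC mulr_natr.
  by split; apply: expand => i; have [] := hc i.
have tail (Y : T -> R) : (forall w, 0 <= Y w) -> measurable_fun [set: T] Y ->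
    (\int[P]_w (approx Y n w)%:E)%E @[n --> \oo] --> P [set w | t < Y w].
  move=> Y0 mY.
  have mtail : measurable [set w | t < Y w].
    rewrite (_ : [set _ | _] = Y @^-1` `]t, +oo[%classic); last first.
      by apply/seteqP; split => w /=; rewrite in_itv/= andbT.
    by rewrite -[X in measurable X]setTI; exact: mY.
  have <- : (\int[P]_w (\1_[set w | (t < Y w)%R] w)%:E = P [set w | (t < Y w)%R])%E.
    by rewrite integral_indic// setIT.
  apply: (@dominated_cvg _ _ _ _ _ _ _ _ (cst 1%E)) => //.
  - move=> n; apply/measurable_EFinP; apply: measurable_funX.
    apply: measurable_funB => //; apply: measurableT_comp => //.
    by apply: measurableT_comp => //; exact: measurable_funM.
  - move=> w _; apply/cvg_EFin => //; first exact: nearW.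
    by rewrite indicE mem_set_bool; exact: indicator_limit.
  - exact: finite_measure_integrable_cst.
  - move=> n w _; rewrite /= lee_fin ger0_norm.
      rewrite exprn_ile1 ?gerBl ?expR_ge0// subr_ge0 -expR0 ler_expR oppr_le0.
      by rewrite mulr_ge0.
    by rewrite exprn_ge0// subr_ge0 -expR0 ler_expR oppr_le0 mulr_ge0.
have measurable_of (Y : T -> R) : (exists a, has_mean P (fun w => expR (- (1%:R * Y w))) a) ->
    measurable_fun [set: T] Y.
  move=> [a /has_mean_measurable mY].
  (* Measurability is part of the existence of the mean of exp(- Y). *)
  rewrite (_ : Y = fun w => - ln (expR (- (1%:R * Y w)))); last first.
    by apply/funext => w; rewrite expRK mul1r opprK.
  by apply: measurableT_comp => //; exact: measurableT_comp.
have [a [h h']] := laplaceE 0%N.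
have tZ := tail Z Z0 (measurable_of _ (ex_intro _ _ h)).
have tZ' := tail Z' Z'0 (measurable_of _ (ex_intro _ _ h')).
have E : (fun n => \int[P]_w (approx Z n w)%:E)%E =
    (fun n => \int[P]_w (approx Z' n w)%:E)%E.
  by apply/funext => n; have [b [[_ ->] [_ ->]]] := approx_mean n.
rewrite E in tZ; exact: (cvg_unique _ tZ tZ').
Qed.

End laplace_uniqueness.

(** * One- and two-point laws of a stable subordinator *)
Section subordinator.
Context d (T : measurableType d) (R : realType) (P : probability T R).
Implicit Types (s t x y h : R) (A B : set R).

Lemma has_mean_indic (E : set T) : measurable E ->
  has_mean P (fun w => (w \in E)%:R) (fine (P E)).
Proof.
move=> mE; apply: has_mean_ge0 => //; first exact: measurable_indic.
by rewrite fineK ?fin_num_measure// -[X in _ = P X]setIT -integral_indic.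
Qed.

(** The properties of a subordinator that are used, without exceptional sets:
times range over the whole line and the process is everywhere nonnegative. *)
Record centred_subordinator (alpha : R) (D : R -> T -> R) : Prop := {
  jointly_measurable : measurable_fun [set: T * R] (fun p => D p.2 p.1);
  nonnegative : forall x w, 0 <= D x w;
  nondecreasing : forall w x y, x <= y -> D x w <= D y w;
  increments_independent : forall x y A B, 0 <= x -> x <= y ->
    measurable A -> measurable B ->
    P (D x @^-1` A `&` (D y \- D x)%R @^-1` B) =
    (P (D x @^-1` A) * P ((D y \- D x)%R @^-1` B))%E;
  increments_stationary : forall x h B, 0 <= x -> 0 <= h -> measurable B ->
    P ((D (x + h) \- D x)%R @^-1` B) = P (D h @^-1` B);
  laplace : forall s x, 0 < s -> 0 <= x ->
    has_mean P (fun w => expR (- (s * D x w))) (expR (- (x * s `^ alpha))) }.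

(** As D_0 = 0 holds only almost surely, D_0 is subtracted; negative times are
sent to 0. Neither operation changes the inverse process outside a null set. *)
Lemma centre_subordinator alpha D : stable_subordinator P alpha D ->
  centred_subordinator alpha (fun x w => D (Num.max x 0) w - D 0 w).
Proof.
move=> [[mD D0 indD statD [rcD _]] ndD lapD].
have max_le x y : x <= y -> Num.max x 0 <= Num.max y 0 
  by move=> xy; rewrite ge_max !le_max xy lexx orbT.
have max_ge0 x : 0 <= Num.max x 0 by rewrite le_max lexx orbT.
split.
- apply: measurable_funB; first exact: measurable_right_continuous_process.
  by apply: measurableT_comp (mD 0 (lexx _)) _; exact: measurable_fst.
- by move=> x w; rewrite subr_ge0; exact: ndD.
- by move=> w x y xy; rewrite lerD2r; apply: ndD => //; exact: max_le.
- move=> x y A B x0 xy mA mB.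
  have := independent_increments_pair indD x0 xy mA mB.
  rewrite !max_l ?(le_trans x0 xy)//.
  congr (P (_ `&` _) = _ * P _)%E; apply/seteqP; split => w /=;
    by rewrite (_ : D y w - D 0 w - (D x w - D 0 w) = D y w - D x w)//; ring.
- move=> x h B x0 h0 mB; rewrite !max_l ?addr_ge0//.
  have := statD x h x0 h0 B mB; have := statD 0 h (lexx _) h0 B mB.
  rewrite add0r => -> <-; congr (P _).
  by apply/seteqP; split => w /=;
    rewrite (_ : D (x + h) w - D 0 w - (D x w - D 0 w) = D (x + h) w - D x w)//; ring.
- move=> s x s0 x0; rewrite max_l//.
  have mexp : measurable_fun [set: T] (fun w => expR (- (s * D x w))).
    apply: measurableT_comp => //; apply: measurableT_comp => //.
    by apply: measurable_funM => //; exact: mD.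
  apply: (@has_mean_ae _ _ _ _ (fun w => expR (- (s * D x w)))).
  + apply: measurableT_comp => //; apply: measurableT_comp => //.
    by apply: measurable_funM => //; apply: measurable_funB; exact: mD.
  + by apply: filterS D0 => w ->; rewrite subr0.
  + apply: has_mean_ge0 => //.
    by have := lapD s x s0 x0; rewrite unlock.
Qed.

Lemma inverse_process_centre D :
  {ae P, forall w, D 0 w = 0} ->
  forall t, {ae P, forall w, inverse_process D t w =
    inverse_process (fun x w => D (Num.max x 0) w - D 0 w) t w}.
Proof.
move=> D0 t; apply: filterS D0 => w D0w; congr inf.
by apply/seteqP; split => x /= [x0]; rewrite max_l// D0w subr0.
Qed.

Section passage.
Variables (alpha : R) (D : R -> T -> R).
Hypothesis hD : centred_subordinator alpha D.

Let mD x : measurable_fun [set: T] (D x).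
Proof. exact: measurableT_comp (jointly_measurable hD) (measurable_pair2 x). Qed.

Let mle x t : measurable [set w | D x w <= t].
Proof.
rewrite (_ : [set _ | _] = D x @^-1` `]-oo, t]%classic); last first.
  by apply/seteqP; split => w /=; rewrite in_itv.
by rewrite -[X in measurable X]setTI; exact: mD.
Qed.

Definition subord_law x t : R := fine (P [set w | D x w <= t]).

Let subord_lawE x t : P [set w | D x w <= t] = (subord_law x t)%:E.
Proof. by rewrite fineK// fin_num_measure. Qed.

Let subord_law_mean x t : has_mean P (fun w => (D x w <= t)%R%:R) (subord_law x t).
Proof.
apply: eq_has_mean (has_mean_indic (mle x t)) => // w.
by rewrite mem_set_bool.
Qed.

Let subord_law_tail x t : (subord_law x t)%:E = (1 - P [set w | (t < D x w)%R])%E.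
Proof.
rewrite (_ : [set w | (t < D x w)%R] = ~` [set w | D x w <= t]); last first.
  by apply/seteqP; split => w /=; rewrite ltNge => /negP.
by rewrite probability_setC// subord_lawE -EFinB subKr.
Qed.

(** Chernoff's bound; its exponential decay in [x] makes all moments of the
inverse finite. *)
Lemma subord_law_le_expR x t : 0 <= x -> subord_law x t <= expR (t - x).
Proof.
move=> x0; have := has_meanZ (expR t) (laplace hD ltr01 x0).
rewrite powR1 mulr1 -expRD; apply: has_mean_le (subord_law_mean x t) => w.
rewrite mul1r; case: (leP (D x w) t) => h /=; last by rewrite mulr_ge0 ?expR_ge0.
by rewrite -expRD -expR0 ler_expR subr_ge0.
Qed.

(** From exp(- D_x) <= 1 on the event D_x <= t and exp(- D_x) <= exp(- t) off it;
the bound is positive for x < t, so the integrals of the law are positive. *)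
Lemma subord_law_ge_expR x t : 0 <= x -> expR (- x) - expR (- t) <= subord_law x t.
Proof.
move=> x0; rewrite lerBlDr.
have := laplace hD ltr01 x0; rewrite powR1 mulr1 => hx.
apply: has_mean_le hx (has_meanD (subord_law_mean x t) (has_mean_cst P (expR (- t)))) => w.
rewrite mul1r; case: (leP (D x w) t) => h /=.
  by rewrite ler_wpDr ?expR_ge0// -expR0 ler_expR oppr_le0 (nonnegative hD).
by rewrite add0r ler_expR lerN2 ltW.
Qed.

(** Self-similarity: both D_x / t and D_(x / t^alpha) have Laplace transform
exp(- x (s / t)^alpha). *)
Lemma subord_law_scale x t : 0 <= x -> 0 < t -> subord_law x t = subord_law (t `^ (- alpha) * x) 1.
Proof.
move=> x0 t0; have c0 : 0 <= t `^ (- alpha) * x by rewrite mulr_ge0 ?powR_ge0.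
have tail : P [set w | 1 < t^-1 * D x w] = P [set w | 1 < D (t `^ (- alpha) * x) w]; last first.
  apply/EFin_inj; rewrite !subord_law_tail -tail; congr (1 - P _)%E.
    by apply/seteqP; split => w /=; rewrite mulrC ltr_pdivlMr// mul1r.
apply: (laplace_tail (P := P)) => [w|w|n].
- by rewrite mulr_ge0 ?invr_ge0 ?(ltW t0)// (nonnegative hD).
- exact: (nonnegative hD).
- exists (expR (- (t `^ (- alpha) * x * n.+1%:R `^ alpha))); split; last exact: laplace.
  have nt0 : 0 < n.+1%:R / t by rewrite divr_gt0.
  apply: eq_has_mean (laplace hD nt0 x0) => [w|]; first by rewrite mulrA.
  congr (expR (- _)); rewrite powRM ?invr_ge0 ?(ltW t0)//.
  rewrite -(powR_inv1 (ltW t0)) -powRrM mulN1r; ring.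
Qed.

Definition joint_subord_law x s y t : R := fine (P ([set w | D x w <= s] `&` [set w | D y w <= t])).

Let joint_subord_lawE x s y t :
  P ([set w | D x w <= s] `&` [set w | D y w <= t]) = (joint_subord_law x s y t)%:E.
Proof. by rewrite fineK// fin_num_measure//; exact: measurableI. Qed.

Lemma joint_subord_law_le x s y t : joint_subord_law x s y t <= subord_law x s.
Proof.
rewrite -lee_fin -joint_subord_lawE -subord_lawE; apply: le_measure; rewrite ?inE//.
exact: measurableI.
Qed.

Lemma joint_subord_law_eq x s y t : y <= x -> s <= t -> joint_subord_law x s y t = subord_law x s.
Proof.
move=> yx st; congr (fine (P _)); apply/seteqP; split => w /= [] // h.
by split => //; apply: le_trans st; apply: le_trans h; exact: (nondecreasing hD).
Qed.

Lemma joint_subord_lawC x s y t : joint_subord_law x s y t = joint_subord_law y t x s.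
Proof. by rewrite /joint_subord_law setIC. Qed.

Lemma subord_law_increment x y s t : 0 <= x -> x <= y ->
  P ([set w | D x w <= s] `&` [set w | D y w - D x w <= t]) =
  (subord_law x s * subord_law (y - x) t)%:E.
Proof.
move=> x0 xy.
have h z : [set w | z w <= t] = z @^-1` `]-oo, t]%classic.
  by apply/seteqP; split => w /=; rewrite in_itv.
have h' z : [set w | z w <= s] = z @^-1` `]-oo, s]%classic.
  by apply/seteqP; split => w /=; rewrite in_itv.
rewrite h h' (increments_independent hD)// EFinM -!subord_lawE h h'; congr (_ * _)%E.
by rewrite -(increments_stationary hD x0) ?subr_ge0// addrC subrK.
Qed.

(** If D_y <= t then D_y - D_x <= t, as D_x >= 0. *)
Lemma joint_subord_law_upper x y s t : 0 <= x -> x <= y ->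
  joint_subord_law x s y t <= subord_law x s * subord_law (y - x) t.
Proof.
move=> x0 xy; rewrite -lee_fin -joint_subord_lawE -subord_law_increment//.
have mi : measurable [set w | D y w - D x w <= t].
  rewrite (_ : [set _ | _] = (D y \- D x)%R @^-1` `]-oo, t]%classic); last first.
    by apply/seteqP; split => w /=; rewrite in_itv.
  by rewrite -[X in measurable X]setTI; apply: measurable_funB.
apply: le_measure; rewrite ?inE; do ?exact: measurableI.
move=> w /= [h1 h2]; split => //; apply: le_trans h2.
by rewrite gerBl (nonnegative hD).
Qed.

(** If D_x <= s and D_y - D_x <= t - s then D_y <= t. *)
Lemma joint_subord_law_lower x y s t : 0 <= x -> x <= y ->
  subord_law x s * subord_law (y - x) (t - s) <= joint_subord_law x s y t.
Proof.
move=> x0 xy; rewrite -lee_fin -joint_subord_lawE -subord_law_increment//.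
have mi : measurable [set w | D y w - D x w <= t - s].
  rewrite (_ : [set _ | _] = (D y \- D x)%R @^-1` `]-oo, t - s]%classic); last first.
    by apply/seteqP; split => w /=; rewrite in_itv.
  by rewrite -[X in measurable X]setTI; apply: measurable_funB.
apply: le_measure; rewrite ?inE; do ?exact: measurableI.
move=> w /= [h1 h2]; split => //.
by have := lerD h1 h2; rewrite addrC subrK [s + _]addrC subrK.
Qed.

End passage.
End subordinator.

(** * The inverse process as an occupation time *)
Definition below (R : realType) (T : Type) (D : R -> T -> R) (t x : R) (w : T) : R :=
  ((0 <= x) && (D x w <= t))%:R.

(** The time after 0 spent in ]-oo, t]. For nondecreasing paths this
is the first passage time above t, in a form to which Tonelli's theorem applies. *)
Definition passage_time (R : realType) (T : Type) (D : R -> T -> R) (t : R) (w : T) :=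
  (\int[@lebesgue_measure R]_x (below D t x w)%:E)%E.

Section passage_time.
Context d (T : measurableType d) (R : realType) (D : R -> T -> R).
Implicit Types (s t x : R).
Hypotheses (mD : measurable_fun [set: T * R] (fun p => D p.2 p.1))
  (ndD : forall w x y, x <= y -> D x w <= D y w).
Local Notation mu := (@lebesgue_measure R).
Local Notation Y := (inverse_process D).
Local Notation below := (below D).
Local Notation passage_time := (passage_time D).

Lemma measurable_below t : measurable_fun [set: T * R] (fun p => below t p.2 p.1).
Proof.
rewrite (_ : (fun p => _) = \1_((fun p => D p.2 p.1) @^-1` `]-oo, t]%classic `&`
    snd @^-1` `[0, +oo[%classic)).
  apply: measurable_indic; apply: measurableI.
    by rewrite -[X in measurable X]setTI; exact: mD.
  by rewrite -[X in measurable X]setTI; exact: measurable_snd.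
apply/funext => -[w x]; rewrite indicE /below /=; congr ((nat_of_bool _)%:R).
apply/idP/idP => [/andP[x0 h]|]; rewrite inE /= !in_itv/= andbT; first by split.
by move=> [-> ->].
Qed.

Lemma measurable_below1 t x : measurable_fun [set: T] (below t x).
Proof. exact: measurableT_comp (measurable_below t) (measurable_pair2 x). Qed.

Lemma measurable_below2 t w : measurable_fun [set: R] (fun x => below t x w).
Proof. exact: measurableT_comp (measurable_below t) (measurable_pair1 w). Qed.

Lemma measurable_passage_time t : measurable_fun [set: T] (passage_time t).
Proof.
apply: (@measurable_fun_fubini_tonelli_F _ _ _ _ _ mu
  (fun p : T * R => (below t p.2 p.1)%:E)).
- by apply/measurable_EFinP; exact: measurable_below.
- by move=> p; rewrite lee_fin.
Qed.

(** By monotonicity the times x >= 0 with D_x <= t fill the interval from 0 to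
Y_t, with or without its right end. *)
Lemma passage_time_hit t w : (exists2 x, 0 <= x & t < D x w) -> passage_time t w = (Y t w)%:E.
Proof.
move=> [x1 x10 tx1]; pose S := [set x : R | 0 <= x /\ t < D x w].
have Sx1 : S x1 by [].
have S0 : lbound S 0 by move=> x [].
have Y0 : 0 <= Y t w by apply: lb_le_inf => //; exists x1.
have mB (b : bool) : (\int[mu]_x (\1_[set` Interval (BLeft 0) (BSide b (Y t w))] x)%:E =
    (Y t w)%:E)%E.
  transitivity (mu [set` Interval (BLeft 0) (BSide b (Y t w))]).
    by rewrite integral_indic// setIT.
  rewrite lebesgue_measure_itv /= lte_fin sube0.
  by move: Y0; rewrite le_eqVlt => /predU1P[<-|->]; rewrite ?ltxx.
apply/eqP; rewrite eq_le; apply/andP; split.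
- rewrite -(mB false); apply: ge0_le_integral => //.
  + by move=> x _; rewrite lee_fin.
  + by apply/measurable_EFinP; exact: measurable_below2.
  + by apply/measurable_EFinP; exact: measurable_indic.
  move=> x _; rewrite lee_fin indicE mem_set_bool ler_nat /below.
  case: (leP 0 x) => //= x0; rewrite in_itv/= x0/=.
  case: (leP (D x w) t) => //= Dx; case: (leP x (Y t w)) => // Yx.
  have [z [z0 tz] zx] := inf_lt (ex_intro _ _ Sx1) Yx.
  by have := lt_le_trans tz (ndD w (ltW zx)); rewrite ltNge Dx.
- rewrite -(mB true); apply: ge0_le_integral => //.
  + by apply/measurable_EFinP; exact: measurable_indic.
  + by apply/measurable_EFinP; exact: measurable_below2.
  move=> x _; rewrite lee_fin indicE mem_set_bool ler_nat /below in_itv/=.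
  case: (leP 0 x) => //= x0; case: (ltP x (Y t w)) => //= xY.
  rewrite leNgt; case: (boolP (t < D x w)) => // tD.
  by move: xY; rewrite ltNge ge_inf//; exists 0.
Qed.

(** If the path never exceeds [t], the infimum of the empty set and the finite
part of an infinite occupation time are both 0 by convention. *)
Lemma inverse_process_fine t w : Y t w = fine (passage_time t w).
Proof.
have [h|nh] := pselect (exists2 x, 0 <= x & t < D x w); first by rewrite passage_time_hit.
rewrite /inverse_process (_ : [set _ | _] = set0); last first.
  by apply/seteqP; split => // x [x0 tx]; apply: nh; exists x.
have -> : passage_time t w = mu `[0, +oo[%classic.
  rewrite -[X in _ = mu X]setIT -integral_indic//.
  apply: eq_integral => x _; rewrite indicE mem_set_bool in_itv/= andbT /below.
  case: (leP 0 x) => //= x0; rewrite leNgt.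
  by case: (boolP (t < D x w)) => // tD; case: nh; exists x.
by rewrite inf0 lebesgue_measure_itv /=; case: ifP.
Qed.

Lemma measurable_inverse t : measurable_fun [set: T] (Y t).
Proof.
rewrite (_ : Y t = fun w => fine (passage_time t w)); last first.
  by apply/funext => w; exact: inverse_process_fine.
by apply: measurableT_comp => //; exact: measurable_passage_time.
Qed.

End passage_time.

Section inverse_process.
Context d (T : measurableType d) (R : realType).
Implicit Type D : R -> T -> R.

Lemma inverse_process_ge0 D t w : 0 <= inverse_process D t w.
Proof.
rewrite /inverse_process; set E := [set _ | _].
have [->|/set0P E0] := eqVneq E set0; first by rewrite inf0.
by apply: lb_le_inf => // x [].
Qed.

(** Only the values at nonnegative times enter the inverse process, so the path
may be made constant before time 0. *)
Lemma measurable_inverse_process D : stochastic_process D ->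
  right_continuous_paths D -> nondecreasing_paths D ->
  stochastic_process (inverse_process D).
Proof.
move=> mD rcD ndD t _.
rewrite (_ : inverse_process D = inverse_process (fun x => D (Num.max x 0))).
  apply: measurable_inverse.
  - exact: measurable_right_continuous_process.
  - move=> w x y xy; apply: ndD; first by rewrite le_max lexx orbT.
    by rewrite ge_max !le_max xy lexx orbT.
apply/funext => r; apply/funext => w; congr inf.
by apply/seteqP; split => x /= [x0]; rewrite max_l.
Qed.

End inverse_process.

(** * Moments of the inverse stable subordinator *)
Section inverse_moments.
Context d (T : measurableType d) (R : realType) (P : probability T R).
Implicit Types (s t x y : R).
Variables (alpha : R) (D : R -> T -> R).
Hypothesis alpha_lt1 : alpha < 1.
Hypothesis hD : centred_subordinator P alpha D.
Local Notation mu := (@lebesgue_measure R).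
Local Notation F := (subord_law P D).
Local Notation FF := (joint_subord_law P D).
Local Notation Y := (inverse_process D).
Local Notation below := (below D).
Local Notation passage_time := (passage_time D).

Let mD := jointly_measurable hD.

(* The laws are extended by 0 to negative times: all integrals are then over the
whole line, where substitutions do not change the domain. *)
Let G t x : R := (0 <= x)%R%:R * F x t.

Let mle x t : measurable [set w | D x w <= t].
Proof.
have m : measurable_fun [set: T] (D x).
  exact: measurableT_comp (jointly_measurable hD) (measurable_pair2 x).
rewrite (_ : [set _ | _] = D x @^-1` `]-oo, t]%classic); last first.
  by apply/seteqP; split => w /=; rewrite in_itv.
by rewrite -[X in measurable X]setTI; exact: m.
Qed.

Let F_ge0 x t : 0 <= F x t. Proof. by rewrite fine_ge0. Qed.

Let G_ge0 t x : 0 <= G t x. Proof. by rewrite mulr_ge0. Qed.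

Let below_mean t x : has_mean P (below t x) (G t x).
Proof.
apply: eq_has_mean (has_meanZ (0 <= x)%R%:R (has_mean_indic P (mle x t))) => // w.
by rewrite mem_set_bool -natrM mulnb.
Qed.

(* As a function of [x] the law is a partial integral of a jointly measurable
function. *)
Let measurable_G t : measurable_fun [set: R] (G t).
Proof.
have := @measurable_fun_fubini_tonelli_G _ _ _ _ _ P
  (fun p => (below t p.2 p.1)%:E).
move=> h; apply/measurable_EFinP; apply: eq_measurable_fun (h _ _).
- by move=> x _ /=; have [_ <-] := below_mean t x.
- by apply/measurable_EFinP; exact: (measurable_below mD).
- by move=> p; rewrite lee_fin.
Qed.

Let J s x t y : R := (0 <= x)%R%:R * (0 <= y)%R%:R * FF x s y t.

Let J_ge0 s x t y : 0 <= J s x t y.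
Proof. by rewrite !mulr_ge0 ?fine_ge0. Qed.

Let J_mean s x t y : has_mean P (fun w => below s x w * below t y w) (J s x t y).
Proof.
apply: eq_has_mean (has_meanZ ((0 <= x)%R%:R * (0 <= y)%R%:R)
  (has_mean_indic P (measurableI _ _ (mle x s) (mle y t)))) => // w.
rewrite (_ : (w \in _) = (D x w <= s) && (D y w <= t)); last first.
  by apply/idP/idP => [|/andP[h1 h2]]; rewrite inE /=; [move=> [-> ->]|split].
by rewrite /below -!natrM !mulnb andbACA.
Qed.

Let measurable_J s t : measurable_fun [set: R * R] (fun p => J s p.1 t p.2).
Proof.
have := @measurable_fun_fubini_tonelli_G _ _ _ _ _ P
  (fun p : T * (R * R) => (below s p.2.1 p.1 * below t p.2.2 p.1)%:E).
move=> h; apply/measurable_EFinP; apply: eq_measurable_fun (h _ _).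
- by move=> [x y] _ /=; have [_ <-] := J_mean s x t y.
- apply/measurable_EFinP; apply: measurable_funM.
  + have m : measurable_fun [set: T * (R * R)] (fun p => (p.1, p.2.1)).
      by apply: measurable_fun_pair => //; exact: measurableT_comp.
    exact: measurableT_comp (measurable_below mD s) m.
  + have m : measurable_fun [set: T * (R * R)] (fun p => (p.1, p.2.2)).
      by apply: measurable_fun_pair => //; exact: measurableT_comp.
    exact: measurableT_comp (measurable_below mD t) m.
- by move=> p; rewrite lee_fin mulr_ge0.
Qed.

Let measurable_J2 s x t : measurable_fun [set: R] (J s x t).
Proof. exact: measurableT_comp (measurable_J s t) (measurable_pair1 x). Qed.

(* The two brackets for the joint law, in a form that can be integrated in [y]:
the part y <= x contributes the length max(x, 0), and the rest a translate of
[G t]. The point y = x may be counted on either side, whence the two kinds of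
interval below. *)
Let J_upper s x t y : s <= t ->
  J s x t y <= G s x * ((0 <= y <= x)%R%:R + G t (y - x)).
Proof.
move=> st; rewrite /J /G; have [x0|x0] := leP 0 x; last by rewrite !mul0r.
have [y0|y0] := leP 0 y; last first.
  by rewrite mulr0 mul0r !mulr_ge0// addr_ge0// mulr_ge0.
rewrite !mul1r; have [yx|xy] := leP y x => /=.
  rewrite (joint_subord_law_eq hD)// ler_peMr// lerDl mulr_ge0//.
by rewrite add0r subr_ge0 (ltW xy) mul1r (joint_subord_law_upper hD)// ltW.
Qed.

Let J_lower s x t y : s <= t ->
  G s x * ((0 <= y < x)%R%:R + G (t - s) (y - x)) <= J s x t y.
Proof.
move=> st; rewrite /J /G; have [x0|x0] := leP 0 x; last by rewrite !mul0r.
have [y0|y0] := leP 0 y; last first.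
  by rewrite subr_ge0 (leNgt x) (lt_le_trans y0 x0) /= mul0r addr0 !mulr0 mul0r.
rewrite !mul1r; have [yx|xy] := ltP y x => /=.
  rewrite (joint_subord_law_eq hD) ?(ltW yx)// subr_ge0 (leNgt x y) yx mul0r addr0.
  by rewrite mulr1.
by rewrite add0r subr_ge0 xy mul1r (joint_subord_law_lower hD).
Qed.

(* These are E Y_t, the limit a(s) of Cov(Y_s, Y_t), and E (Y_s Y_t). *)
Let U t : \bar R := (\int[mu]_x (G t x)%:E)%E.

Let A s : \bar R := (\int[mu]_x (G s x * Num.max x 0)%:E)%E.

Let Q s t : \bar R := (\int[mu]_x \int[mu]_y (J s x t y)%:E)%E.

Let U_ge0 t : (0 <= U t)%E.
Proof. by apply: integral_ge0 => x _; rewrite lee_fin. Qed.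

Let A_ge0 t : (0 <= A t)%E.
Proof. by apply: integral_ge0 => x _; rewrite lee_fin mulr_ge0// le_max lexx orbT. Qed.

Let Q_ge0 s t : (0 <= Q s t)%E.
Proof. by apply: integral_ge0 => x _; apply: integral_ge0 => y _; rewrite lee_fin. Qed.

Let measurable_pos : measurable_fun [set: R] (fun x : R => Num.max x 0).
Proof. exact: (measurable_maxr (@measurable_id _ _ _) (measurable_cst _)). Qed.

Let integral_shift x t : (\int[mu]_y (G t (y - x))%:E = U t)%E.
Proof.
rewrite /U (@integral_affine _ 1 (- x) setT (fun y => (G t y)%:E))//; last 2 first.
- by apply/measurable_EFinP; exact: measurable_G.
- by move=> y _; rewrite lee_fin.
by rewrite mul1e preimage_setT; under [RHS]eq_integral do rewrite mul1r.
Qed.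

(* [y < x ?<= if b] is y <= x if [b] holds, and y < x otherwise. *)
Let integral_cut x (b : bool) :
  (\int[mu]_y (((0 <= y) && (y < x ?<= if b))%R%:R)%:E = (Num.max x 0)%:E)%E.
Proof.
pose I := Interval (BLeft 0) (BSide (~~ b) x).
transitivity (mu [set` I]).
  rewrite -[X in _ = mu X]setIT -integral_indic//.
  apply: eq_integral => y _; rewrite indicE mem_set_bool; congr ((_%:R)%:E).
  by rewrite /I in_itv /=; case: b {I}.
rewrite lebesgue_measure_itv /= lte_fin; case: ifPn => x0.
  by rewrite sube0 max_l// ltW.
by rewrite max_r// leNgt.
Qed.

Let measurable_cut x (b : bool) :
  measurable_fun [set: R] (fun y => ((0 <= y) && (y < x ?<= if b))%R%:R : R).
Proof.
pose I := Interval (BLeft 0) (BSide (~~ b) x).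
rewrite (_ : (fun y => _) = \1_[set` I]); first exact: measurable_indic.
apply/funext => y; rewrite indicE mem_set_bool; congr (_%:R).
by rewrite /I in_itv /=; case: b {I}.
Qed.

Let measurable_shift x t : measurable_fun [set: R] (fun y => G t (y - x)).
Proof. by apply: measurableT_comp (measurable_G t) _; exact: measurable_funB. Qed.

Let measurable_slice s x t b : measurable_fun [set: R]
  (fun y => (G s x * (((0 <= y) && (y < x ?<= if b))%R%:R + G t (y - x)))%:E).
Proof.
by apply/measurable_EFinP; apply: measurable_funM => //; exact: measurable_funD.
Qed.

Let integral_split s x t b :
  (\int[mu]_y (G s x * (((0 <= y) && (y < x ?<= if b))%R%:R + G t (y - x)))%:E =
   (G s x * Num.max x 0)%:E + (G s x)%:E * U t)%E.
Proof.
under eq_integral do rewrite EFinM.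
have mcut := measurable_cut x b; have mshift := measurable_shift x t.
rewrite ge0_integralZl//; last 3 first.
- by apply/measurable_EFinP; exact: measurable_funD.
- by move=> y _; rewrite lee_fin addr_ge0.
- by rewrite lee_fin.
under eq_integral do rewrite EFinD.
rewrite ge0_integralD//; last 3 first.
- exact/measurable_EFinP.
- by move=> y _; rewrite lee_fin.
- exact/measurable_EFinP.
by rewrite integral_cut integral_shift ge0_muleDr// ?lee_fin ?le_max ?lexx ?orbT// EFinM.
Qed.
Let integral_total s t :
  (\int[mu]_x ((G s x * Num.max x 0)%:E + (G s x)%:E * U t) = A s + U s * U t)%E.
Proof.
rewrite ge0_integralD//.
- congr (_ + _)%E; rewrite ge0_integralZr//; last by move=> x _; rewrite lee_fin.
  by apply/measurable_EFinP; exact: measurable_G.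
- by move=> x _; rewrite lee_fin mulr_ge0// le_max lexx orbT.
- by apply/measurable_EFinP; apply: measurable_funM; [exact: measurable_G|exact: measurable_pos].
- by move=> x _; rewrite mule_ge0// lee_fin.
- by apply: emeasurable_funM => //; apply/measurable_EFinP; exact: measurable_G.
Qed.

Let measurable_intJ s t : measurable_fun [set: R] (fun x => \int[mu]_y (J s x t y)%:E)%E.
Proof.
apply: (@measurable_fun_fubini_tonelli_F _ _ _ _ _ mu (fun p => (J s p.1 t p.2)%:E)).
- by apply/measurable_EFinP; exact: measurable_J.
- by move=> p; rewrite lee_fin.
Qed.

Let measurable_bound s t :
  measurable_fun [set: R] (fun x => (G s x * Num.max x 0)%:E + (G s x)%:E * U t)%E.
Proof.
apply: emeasurable_funD.
  by apply/measurable_EFinP; apply: measurable_funM; [exact: measurable_G|exact: measurable_pos].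
by apply: emeasurable_funM => //; apply/measurable_EFinP; exact: measurable_G.
Qed.

Let Q_upper s t : s <= t -> (Q s t <= A s + U s * U t)%E.
Proof.
move=> st; rewrite -integral_total; apply: ge0_le_integral => //.
- by move=> x _; apply: integral_ge0 => y _; rewrite lee_fin.
- exact: measurable_intJ.
- exact: measurable_bound.
move=> x _; rewrite -(integral_split s x t true); apply: ge0_le_integral => //.
- by move=> y _; rewrite lee_fin.
- by apply/measurable_EFinP; exact: measurable_J2.
- exact: measurable_slice.
- by move=> y _; rewrite lee_fin J_upper.
Qed.

Let Q_lower s t : s <= t -> (A s + U s * U (t - s) <= Q s t)%E.
Proof.
move=> st; rewrite -integral_total; apply: ge0_le_integral => //.
- by move=> x _; rewrite adde_ge0// ?mule_ge0// ?lee_fin// mulr_ge0// le_max lexx orbT.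
- exact: measurable_bound.
- exact: measurable_intJ.
move=> x _; rewrite -(integral_split s x (t - s) false); apply: ge0_le_integral => //.
- by move=> y _; rewrite lee_fin mulr_ge0// addr_ge0.
- exact: measurable_slice.
- by apply/measurable_EFinP; exact: measurable_J2.
- by move=> y _; rewrite lee_fin J_lower.
Qed.

(* The function exp(- x / 2) on the half-line, taken as a multiple of an
exponential density because the integral of the latter is known. *)
Let e (x : R) : R := 2 * exponential_pdf 2^-1 x.

Let e_ge0 x : 0 <= e x.
Proof. by rewrite mulr_ge0// exponential_pdf_ge0. Qed.

Let eE x : 0 <= x -> e x = expR (- (x / 2)).
Proof.
move=> x0; rewrite /e /exponential_pdf patchE ifT; last first.
  by rewrite inE/= in_itv/= x0.
by rewrite mulrA divff// mul1r mulNr mulrC.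
Qed.

Let measurable_e : measurable_fun [set: R] e.
Proof. by apply: measurable_funM => //; exact: measurable_exponential_pdf. Qed.

Let integral_e : (\int[mu]_x (e x)%:E = 2%:E)%E.
Proof.
under eq_integral do rewrite EFinM.
rewrite ge0_integralZl//.
- by rewrite integral_exponential_pdf// mule1.
- by apply/measurable_EFinP; exact: measurable_exponential_pdf.
- by move=> x _; rewrite lee_fin exponential_pdf_ge0.
Qed.

Let F_le_e t x : 0 <= x -> F x t <= expR t * expR (- x).
Proof. by move=> x0; rewrite -expRD; exact: (subord_law_le_expR hD). Qed.

Let U_fin t : U t = (fine (U t))%:E.
Proof.
rewrite fineK// ge0_fin_numE//.
apply: (@le_lt_trans _ _ (\int[mu]_x (expR t * e x)%:E)%E).
  apply: ge0_le_integral => //.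
  - by move=> x _; rewrite lee_fin.
  - by apply/measurable_EFinP; exact: measurable_G.
  - by apply/measurable_EFinP; apply: measurable_funM.
  - move=> x _; rewrite lee_fin /G; have [x0|x0] := leP 0 x; last first.
      by rewrite mul0r mulr_ge0 ?expR_ge0.
    rewrite mul1r eE// (le_trans (F_le_e t x0))// ler_wpM2l ?expR_ge0//.
    by rewrite ler_expR lerN2 ler_pdivrMr// ler_peMr// ler1n.
under eq_integral do rewrite EFinM.
rewrite ge0_integralZl//; last 2 first.
- exact/measurable_EFinP.
- by move=> x _; rewrite lee_fin.
by rewrite integral_e -EFinM ltry.
Qed.

(* P(D_max(x, y) <= t) <= exp(t - max(x, y)) and max(x, y) >= (x + y) / 2: the
decay is split evenly between the two variables. *)
Let J_le_e t x y : J t x t y <= expR t * e x * e y.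
Proof.
rewrite /J.
have [x0|x0] := leP 0 x; last first.
  by rewrite !mul0r mulr_ge0// mulr_ge0// expR_ge0.
have [y0|y0] := leP 0 y; last first.
  by rewrite mulr0 mul0r mulr_ge0// mulr_ge0// expR_ge0.
rewrite !mul1r !eE// -mulrA -expRD.
have key z : 0 <= z -> x / 2 + y / 2 <= z -> F z t <=
    expR t * expR (- (x / 2) + - (y / 2)).
  move=> z0 xyz; rewrite (le_trans (F_le_e t z0))// ler_wpM2l ?expR_ge0//.
  by rewrite ler_expR -opprD lerN2.
have [xy|yx] := leP x y.
  rewrite joint_subord_lawC; apply: le_trans (joint_subord_law_le hD _ _ _ _) _.
  by apply: key => //; lra.
by apply: le_trans (joint_subord_law_le hD _ _ _ _) _; apply: key => //; lra.
Qed.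

Let Q_diag_fin t : (Q t t < +oo)%E.
Proof.
apply: (@le_lt_trans _ _ (\int[mu]_x \int[mu]_y ((expR t * e x) * e y)%:E)%E).
  apply: ge0_le_integral => //.
  - by move=> x _; apply: integral_ge0 => y _; rewrite lee_fin.
  - exact: measurable_intJ.
  - under eq_fun => x.
      under eq_integral do rewrite EFinM.
      rewrite ge0_integralZl//; last 3 first.
      + exact/measurable_EFinP.
      + by move=> y _; rewrite lee_fin.
      + by rewrite lee_fin mulr_ge0// expR_ge0.
      over.
    apply: emeasurable_funM => //; apply/measurable_EFinP; exact: measurable_funM.
  move=> x _; apply: ge0_le_integral => //.
  - by move=> y _; rewrite lee_fin.
  - by apply/measurable_EFinP; exact: measurable_J2.
  - by apply/measurable_EFinP; exact: measurable_funM.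
  by move=> y _; rewrite lee_fin J_le_e.
under eq_integral => x _.
  under eq_integral do rewrite EFinM.
  rewrite ge0_integralZl//; last 3 first.
  + exact/measurable_EFinP.
  + by move=> y _; rewrite lee_fin.
  + by rewrite lee_fin mulr_ge0// expR_ge0.
  rewrite integral_e -EFinM -mulrA (mulrC (e x)) mulrA EFinM.
  over.
rewrite ge0_integralZl//; last 2 first.
- exact/measurable_EFinP.
- by move=> x _; rewrite lee_fin.
by rewrite integral_e -EFinM ltry.
Qed.

(* Finiteness passes from Q on the diagonal to A by the lower bracket, and then
to all of Q by the upper one. *)
Let A_fin s : A s = (fine (A s))%:E.
Proof.
rewrite fineK// ge0_fin_numE//; apply: le_lt_trans (Q_diag_fin s).
by apply: le_trans (Q_lower (lexx s)); rewrite leeDl// mule_ge0.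
Qed.

Let Q_fin s t : s <= t -> Q s t = (fine (Q s t))%:E.
Proof.
move=> st; rewrite fineK// ge0_fin_numE//; apply: le_lt_trans (Q_upper st) _.
by rewrite A_fin (U_fin s) (U_fin t) -EFinM -EFinD ltry.
Qed.

(* P(D_n <= t) <= exp(t - n) for all n, so almost every path exceeds t. *)
Let hit_ae t : {ae P, forall w, exists2 x, 0 <= x & t < D x w}.
Proof.
pose N := \bigcap_(n : nat) [set w | D n%:R w <= t].
have mN : measurable N by apply: bigcapT_measurable => n; exact: mle.
exists N; split => //; last first.
  move=> w /= nh n _ /=; rewrite leNgt; apply/negP => tD; apply: nh.
  by exists n%:R.
have PN n : fine (P N) <= expR (t - n%:R).
  apply: le_trans (subord_law_le_expR hD t (ler0n _ n)).
  apply: fine_le; rewrite ?fin_num_measure//.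
  by apply: le_measure; rewrite ?inE// => w; exact.
apply/eqP; rewrite -(fineK (fin_num_measure P _ mN)) eqe.
rewrite eq_le fine_ge0// andbT leNgt; apply/negP => p0.
pose n := (Num.truncn (t - ln (fine (P N)))).+1.
have := PN n; rewrite leNgt => /negP; apply.
rewrite -[ltRHS]lnK ?posrE// ltr_expR ltrBlDr -ltrBlDl.
exact: truncnS_gt.
Qed.

Let measurable_Y t : measurable_fun [set: T] (Y t).
Proof. exact: (measurable_inverse mD (nondecreasing hD)). Qed.

Let Y_ge0 t w : 0 <= Y t w.
Proof. exact: inverse_process_ge0. Qed.

Let tonelli (f : T * R -> \bar R) : measurable_fun [set: T * R] f ->
  (forall p, 0 <= f p)%E ->
  (\int[P]_w \int[mu]_x f (w, x) = \int[mu]_x \int[P]_w f (w, x))%E.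
Proof. by move=> mf f0; exact: (@fubini_tonelli _ _ _ _ _ P mu f mf f0). Qed.

Let inverse_mean t : has_mean P (Y t) (fine (U t)).
Proof.
apply: has_mean_ge0 => //.
transitivity (\int[P]_w passage_time t w)%E.
  apply: ae_eq_integral => //; [exact/measurable_EFinP|exact: measurable_passage_time|].
  by apply: filterS (hit_ae t) => w h _; rewrite (passage_time_hit mD (nondecreasing hD)).
rewrite -U_fin; apply: (etrans (@tonelli (fun p : T * R => (below t p.2 p.1)%:E) _ _)); last first.
- by apply: eq_integral => x _; have [_ <-] := below_mean t x.
- by move=> p; rewrite lee_fin.
- by apply/measurable_EFinP; exact: (measurable_below mD).
Qed.

Let inverse_mean2 s t : s <= t -> has_mean P (fun w => Y s w * Y t w) (fine (Q s t)).
Proof.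
move=> st; apply: has_mean_ge0; [exact: measurable_funM|by move=> w; rewrite mulr_ge0|].
transitivity (\int[P]_w (passage_time s w * passage_time t w))%E.
  apply: ae_eq_integral => //; first by apply/measurable_EFinP; exact: measurable_funM.
    by apply: emeasurable_funM; exact: measurable_passage_time.
  by apply: filterS2 (hit_ae s) (hit_ae t) => w hs ht _;
    rewrite !(passage_time_hit mD (nondecreasing hD)).
have pt_ge0 r w : (0 <= passage_time r w)%E.
  by apply: integral_ge0 => x _; rewrite lee_fin.
transitivity (\int[P]_w \int[mu]_x ((below s x w)%:E * passage_time t w))%E.
  apply: eq_integral => w _; rewrite ge0_integralZr//.
  - by apply/measurable_EFinP; exact: (measurable_below2 mD).
  - by move=> x _; rewrite lee_fin.
rewrite -Q_fin//.
apply: (etrans (@tonelli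
  (fun p : T * R => (below s p.2 p.1)%:E * passage_time t p.1)%E _ _)); last first.
- apply: eq_integral => x _ /=.
  transitivity (\int[P]_w \int[mu]_y (below s x w * below t y w)%:E)%E.
    apply: eq_integral => w _; under [RHS]eq_integral do rewrite EFinM.
    rewrite ge0_integralZl// ?lee_fin//; last by move=> y _; rewrite lee_fin.
    by apply/measurable_EFinP; exact: (measurable_below2 mD).
  apply: (etrans (@tonelli
    (fun p : T * R => (below s x p.1 * below t p.2 p.1)%:E) _ _)); last first.
  + by apply: eq_integral => y _; have [_ <-] := J_mean s x t y.
  + by move=> p; rewrite lee_fin mulr_ge0.
  + apply/measurable_EFinP; apply: measurable_funM; last exact: (measurable_below mD).
    exact: measurableT_comp (measurable_below1 mD s x) measurable_fst.
- by move=> p; rewrite mule_ge0// lee_fin.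
- apply: emeasurable_funM; first by apply/measurable_EFinP; exact: (measurable_below mD).
  exact: measurableT_comp (measurable_passage_time mD t) measurable_fst.
Qed.

Let G_scale t x : 0 < t -> G t x = G 1 (t `^ (- alpha) * x).
Proof.
move=> t0; rewrite /G pmulr_rge0 ?powR_gt0//.
by have [x0|//] := leP 0 x; [rewrite (subord_law_scale hD x0 t0)|rewrite !mul0r].
Qed.

(* On the diagonal s = t the joint law is a law at the later time, so the scaling
of one-point laws is enough. *)
Let J_diag t x y : J t x t y = (0 <= x)%R%:R * (0 <= y)%R%:R * F (Num.max x y) t.
Proof.
rewrite /J; congr (_ * _); have [xy|/ltW yx] := leP x y.
  by rewrite joint_subord_lawC (joint_subord_law_eq hD).
by rewrite (joint_subord_law_eq hD).
Qed.

Let J_scale t x y : 0 < t ->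
  J t x t y = J 1 (t `^ (- alpha) * x) 1 (t `^ (- alpha) * y).
Proof.
move=> t0; have c0 : 0 < t `^ (- alpha) by rewrite powR_gt0.
rewrite !J_diag !pmulr_rge0// -maxr_pMr ?(ltW c0)//.
have [x0|x0] := leP 0 x; last by rewrite !mul0r.
have [y0|y0] := leP 0 y; last by rewrite mulr0 !mul0r.
by rewrite (subord_law_scale hD)// le_max x0.
Qed.

Let powR_cancel t : 0 < t -> t `^ alpha * t `^ (- alpha) = 1.
Proof.
by move=> t0; rewrite -powRD ?subrr ?powRr0//; apply/implyP => _; rewrite gt_eqF.
Qed.

Let U_scale t : 0 < t -> fine (U t) = fine (U 1) * t `^ alpha.
Proof.
move=> t0; have c0 : 0 < t `^ (- alpha) by rewrite powR_gt0.
have : U 1 = ((t `^ (- alpha))%:E * U t)%E.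
  rewrite [LHS](@integral_affine _ (t `^ (- alpha)) 0 setT (fun x => (G 1 x)%:E))//.
  - rewrite preimage_setT; congr (_ * _)%E.
    by apply: eq_integral => x _; rewrite addr0 -G_scale.
  - by apply/measurable_EFinP; exact: measurable_G.
  - by move=> x _; rewrite lee_fin.
move=> ->; rewrite (U_fin t) -EFinM /=.
by rewrite mulrC mulrA powR_cancel// mul1r.
Qed.

Let Q_scale t : 0 < t -> fine (Q t t) = fine (Q 1 1) * (t `^ alpha) ^+ 2.
Proof.
move=> t0; have c0 : 0 < t `^ (- alpha) by rewrite powR_gt0.
set c := t `^ (- alpha) in c0.
have inner x : (\int[mu]_y (J 1 x 1 y)%:E = c%:E * \int[mu]_y (J 1 x 1 (c * y))%:E)%E.
  rewrite [LHS](@integral_affine _ c 0 setT (fun y => (J 1 x 1 y)%:E))//.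
  - by rewrite preimage_setT; under eq_integral do rewrite addr0.
  - by apply/measurable_EFinP; exact: measurable_J2.
  - by move=> y _; rewrite lee_fin.
have QE : Q 1 1 = (c%:E * (c%:E * Q t t))%E.
  rewrite [LHS](@integral_affine _ c 0 setT (fun x => \int[mu]_y (J 1 x 1 y)%:E)%E)//.
  - rewrite preimage_setT; congr (_ * _)%E.
    transitivity (\int[mu]_x (c%:E * \int[mu]_y (J t x t y)%:E))%E.
      apply: eq_integral => x _; rewrite addr0 inner; congr (_ * _)%E.
      by apply: eq_integral => y _; rewrite -J_scale.
    apply: ge0_integralZl; [exact: measurableT|exact: measurable_intJ| |].
    + by move=> x _; apply: integral_ge0 => y _; rewrite lee_fin.
    + by rewrite lee_fin ltW.
  - by move=> x _; apply: integral_ge0 => y _; rewrite lee_fin.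
rewrite QE (Q_fin (lexx t)) -!EFinM /=.
rewrite (_ : c * (c * _) * _ = fine (Q t t) * (t `^ alpha * c) ^+ 2); last by ring.
by rewrite powR_cancel// expr1n mulr1.
Qed.

Let integral_gt0 (f : R -> R) a b c : measurable_fun [set: R] f ->
  (forall x, 0 <= f x) -> 0 < c -> a < b ->
  (forall x, a <= x <= b -> c <= f x) -> (0 < \int[mu]_x (f x)%:E)%E.
Proof.
move=> mf f0 c0 ab fc.
apply: (@lt_le_trans _ _ (\int[mu]_x (c%:E * (\1_[set` `[a, b]] x)%:E))%E).
  rewrite ge0_integralZl; last first.
  - by rewrite lee_fin ltW.
  - by move=> x _; rewrite lee_fin.
  - by apply/measurable_EFinP; exact: measurable_indic.
  - exact: measurableT.
  have -> : (\int[mu]_x (\1_[set` `[a, b]] x)%:E = (b - a)%:E)%E.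
    transitivity (mu [set` `[a, b]]); first by rewrite integral_indic// setIT.
    by rewrite lebesgue_measure_itv /= lte_fin ab -EFinB.
  by rewrite -EFinM lte_fin mulr_gt0// subr_gt0.
apply: ge0_le_integral => //.
- by move=> x _; rewrite -EFinM lee_fin mulr_ge0// ltW.
- by apply/measurable_EFinP; apply: measurable_funM => //; exact: measurable_indic.
- exact/measurable_EFinP.
- move=> x _; rewrite -EFinM lee_fin indicE mem_set_bool.
  case: (boolP (x \in `[a, b])) => [|_]; last by rewrite mulr0.
  by rewrite in_itv/= mulr1; exact: fc.
Qed.

Let F_lower s x : 0 < s -> 0 <= x <= s / 2 -> expR (- (s / 2)) - expR (- s) <= F x s.
Proof.
move=> s0 /andP[x0 xs]; apply: le_trans (subord_law_ge_expR hD s x0).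
by rewrite lerD2r ler_expR lerN2.
Qed.

Let F_lower_gt0 s : 0 < s -> 0 < expR (- (s / 2)) - expR (- s).
Proof. by move=> s0; rewrite subr_gt0 ltr_expR; lra. Qed.

Let U_gt0 : 0 < fine (U 1).
Proof.
rewrite -lte_fin -U_fin.
apply: (@integral_gt0 _ 0 (1 / 2) _ _ _ (F_lower_gt0 (@ltr01 R))) => //.
move=> x /[dup] /andP[x0 _] /(F_lower (@ltr01 R)) h.
have -> : G 1 x = F x 1 by rewrite /G x0 mul1r.
exact: h.
Qed.

Let A_gt0 s : 0 < s -> 0 < fine (A s).
Proof.
move=> s0; rewrite -lte_fin -A_fin.
apply: (@integral_gt0 _ (s / 4) (s / 2) ((expR (- (s / 2)) - expR (- s)) * (s / 4))).
- by apply: measurable_funM; [exact: measurable_G|exact: measurable_pos].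
- by move=> x; rewrite mulr_ge0// le_max lexx orbT.
- by rewrite mulr_gt0 ?F_lower_gt0// divr_gt0.
- lra.
- move=> x /andP[x1 x2]; have x0 : 0 <= x by lra.
  rewrite ler_pM// ?(ltW (F_lower_gt0 s0))//.
  + lra.
  + by rewrite /G x0 mul1r F_lower// x0.
  + by rewrite le_max x1.
Qed.

(* If Y_1 = c almost surely then D_(c/2) <= 1 almost surely, so its Laplace
transform exp(- (c/2) s^alpha) is at least exp(- s). *)
Let inverse_not_constant c : 0 < c -> ~ {ae P, forall w, Y 1 w = c}.
Proof.
move=> c0 Yc; pose x := c / 2; have x0 : 0 < x by rewrite divr_gt0.
have Dx : {ae P, forall w, D x w <= 1}.
  apply: filterS Yc => w Yw; rewrite leNgt; apply/negP => D1.
  have : Y 1 w <= x by apply: ge_inf; [exists 0 => y []|split => //; exact: ltW].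
  by rewrite Yw /x; lra.
have bound s : 0 < s -> x * s `^ alpha <= s.
  move=> s0; rewrite -[leLHS]opprK -[leRHS]opprK lerN2 -ler_expR.
  have hl := laplace hD s0 (ltW x0).
  have ml := has_mean_measurable hl.
  have hl' : has_mean P (fun w => Num.max (expR (- (s * D x w))) (expR (- s)))
      (expR (- (x * s `^ alpha))).
    apply: has_mean_ae hl; first exact: (measurable_maxr ml (measurable_cst _)).
    apply: filterS Dx => w Dw; rewrite max_l// ler_expR lerN2.
    by rewrite ler_piMr// ltW.
  apply: has_mean_le (has_mean_cst P _) hl' => w.
  by rewrite le_max lexx orbT.
(* The solution of s^(1 - alpha) = x / 2, which violates the bound. *)
pose s := (x / 2) `^ (1 - alpha)^-1.
have a1 : 0 < 1 - alpha by rewrite subr_gt0.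
have s0 : 0 < s by rewrite powR_gt0// divr_gt0.
have := bound s s0.
have sE : s = x / 2 * s `^ alpha.
  rewrite -[LHS]powRr1 ?ltW// -{1}(subrK alpha 1) powRD; last first.
    by apply/implyP => _; rewrite gt_eqF.
  congr (_ * _); rewrite -powRrM mulVf ?gt_eqF// powRr1// ltW// divr_gt0//.
rewrite {2}sE ler_pM2r ?powR_gt0//; lra.
Qed.

(* The variance of Y_1 vanishes only if Y_1 is almost surely constant. *)
Let Q_gt : fine (U 1) ^+ 2 < fine (Q 1 1).
Proof.
set u := fine (U 1).
have hY := inverse_mean 1; have hYY := inverse_mean2 (lexx 1).
have hV : has_mean P (fun w => (Y 1 w - u) ^+ 2) (fine (Q 1 1) - u ^+ 2).
  apply: eq_has_mean (has_meanD hYY (has_meanD (has_meanZ (- (2 * u)) hY)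
    (has_mean_cst P (u ^+ 2)))) => [w|]; first by rewrite /=; ring.
  by rewrite -/u; ring.
have mV := has_mean_measurable hV.
rewrite -subr_gt0 lt_def; apply/andP; split; last first.
  by apply: has_mean_le (has_mean_cst P 0) hV => w; exact: sqr_ge0.
apply/eqP => V0; apply: (inverse_not_constant U_gt0).
move: hV; rewrite V0 => -[_ IV].
have /ae_eq_integral_abs : (\int[P]_w `|(EFin \o (fun w => (Y 1 w - u) ^+ 2)%R) w| = 0)%E.
  transitivity (\int[P]_w ((Y 1 w - u) ^+ 2)%:E)%E; last exact: IV.
  by apply: eq_integral => w _; rewrite /= ger0_norm// sqr_ge0.
move=> /(_ measurableT) h; apply: filterS (h _) => [w /(_ I) /= [] /eqP|].
  by rewrite sqrf_eq0 subr_eq0 => /eqP.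
exact/measurable_EFinP.
Qed.

(** In this form the covariance of Y_s and Y_t is known up to an error
u^2 s^alpha (t^alpha - (t - s)^alpha), and no value of a Beta integral is needed.
The third clause covers all real t, among them t = 0, where scaling says
nothing but square integrability is still required. *)
Lemma inverse_subordinator_moments : exists (u q : R) (a : R -> R),
  [/\ 0 < u /\ u ^+ 2 < q, (forall s, 0 < s -> 0 < a s),
    (forall t, exists m v, has_mean P (Y t) m /\ has_mean P (fun w => Y t w * Y t w) v),
    (forall t, 0 < t -> has_mean P (Y t) (u * t `^ alpha) /\
      has_mean P (fun w => Y t w * Y t w) (q * (t `^ alpha) ^+ 2)) &
    forall s t, 0 < s -> s < t -> exists c,
      has_mean P (fun w => Y s w * Y t w) c /\
      a s + (u * s `^ alpha) * (u * (t - s) `^ alpha) <= c <=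
      a s + (u * s `^ alpha) * (u * t `^ alpha)].
Proof.
exists (fine (U 1)), (fine (Q 1 1)), (fun s => fine (A s)); split => //.
- by move=> t; exists (fine (U t)), (fine (Q t t)); split;
    [exact: inverse_mean|exact: inverse_mean2].
- by move=> t t0; rewrite -U_scale// -Q_scale//; split;
    [exact: inverse_mean|exact: inverse_mean2].
- move=> s t s0 st; have t0 := lt_trans s0 st.
  exists (fine (Q s t)); split; first exact: inverse_mean2 (ltW st).
  rewrite -!U_scale ?subr_gt0//.
  have := Q_lower (ltW st); have := Q_upper (ltW st).
  rewrite (Q_fin (ltW st)) A_fin (U_fin s) (U_fin t) (U_fin (t - s)).
  by rewrite -!EFinM -!EFinD !lee_fin => -> ->.
Qed.

Lemma inverse_process_nondecreasing s t : s <= t -> {ae P, forall w, Y s w <= Y t w}.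
Proof.
move=> st; apply: filterS (hit_ae t) => w [x x0 tx].
apply: lb_le_inf; first by exists x.
move=> y [y0 ty]; apply: ge_inf; first by exists 0 => z [].
by split => //; exact: le_lt_trans ty.
Qed.

End inverse_moments.

(** * Time change by an independent process *)
Section subordination.
Context d (T : measurableType d) (R : realType) (P : probability T R).
Variables (m V : R) (S Y : R -> T -> R).
Hypothesis momS : levy_moments P m V S.
Hypotheses (mS : stochastic_process S) (rcS : right_continuous_paths S).
Hypotheses (mY : stochastic_process Y) (Y_ge0 : forall t w, 0 <= Y t w).
Hypothesis SY : independent_processes P S Y.

(* S and Y are seen as the identity maps from [T] to [T] with the sigma-algebra
generated by S, respectively by Y. These two maps are independent random
elements, and the value S_(Y_t) is a jointly measurable function of them. *)
Let G (Z : R -> T -> R) := \bigcup_(t in [set t : R | 0 <= t]) sigma_of (Z t).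

Let TS := g_sigma_algebraType (G S).
Let TY := g_sigma_algebraType (G Y).

Let measurable_generated (Z : R -> T -> R) t : 0 <= t ->
  measurable_fun [set: g_sigma_algebraType (G Z)] (Z t : g_sigma_algebraType (G Z) -> R).
Proof. by move=> t0 _ B mB; rewrite setTI; exact: sigma_of_processP. Qed.

Let measurable_id_generated (Z : R -> T -> R) : stochastic_process Z ->
  measurable_fun [set: T] (id : T -> g_sigma_algebraType (G Z)).
Proof.
move=> mZ _ B mB; rewrite setTI.
suff sub : <<s G Z>> `<=` @measurable d T by exact: sub.
apply: smallest_sub; first exact: sigma_algebra_measurable.
by move=> A [t t0 [C mC <-]]; exact: mZ.
Qed.

Let measurable_S : measurable_fun [set: TS * R] (fun p => S (Num.max p.2 0) p.1).
Proof.
apply: measurable_right_continuous_process; last exact: rcS.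
exact: measurable_generated.
Qed.

Let value t (p : TS * TY) : R := S (Num.max (Y t p.2) 0) p.1.

Let measurable_value t : 0 <= t -> measurable_fun [set: TS * TY] (value t).
Proof.
move=> t0.
have mp : measurable_fun [set: TS * TY] (fun p => (p.1, Y t p.2) : TS * R).
  apply: measurable_fun_pair => //.
  exact: measurableT_comp (measurable_generated t0) _.
exact: measurableT_comp measurable_S mp.
Qed.

Let valueE t w v : value t (w, v) = S (Y t v) w.
Proof. by rewrite /value /= max_l. Qed.

Let independent_generated A B : measurable A -> measurable B ->
  P ((id : T -> TS) @^-1` A `&` (id : T -> TY) @^-1` B) =
  (P ((id : T -> TS) @^-1` A) * P ((id : T -> TY) @^-1` B))%E.
Proof. by move=> mA mB; exact: SY. Qed.

Lemma measurable_subordinated t : 0 <= t -> measurable_fun [set: T] (fun w => S (Y t w) w).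
Proof.
move=> t0.
have mp : measurable_fun [set: T] (fun w => (w, w) : TS * TY).
  by apply: measurable_fun_pair; exact: measurable_id_generated.
have := measurableT_comp (measurable_value t0) mp.
by apply: eq_measurable_fun => w _; rewrite /= valueE.
Qed.

Let sqr_mean (a : R) : 0 <= a -> has_mean P (fun w => S a w ^+ 2) (V * a + m ^+ 2 * a ^+ 2).
Proof.
move=> a0; apply: eq_has_mean (momS a0 a0).2 => [w|]; first by rewrite expr2.
by rewrite minxx expr2.
Qed.

(** The second moment of Y_t is used for integrability only, through
|x| <= 1 + x^2. *)
Lemma subordinated_mean t y z : 0 <= t ->
  has_mean P (Y t) y -> has_mean P (fun w => Y t w * Y t w) z ->
  has_mean P (fun w => S (Y t w) w) (m * y).
Proof.
move=> t0 hy hz.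
have mS' := measurable_id_generated mS; have mY' := measurable_id_generated mY.
have := @independent_has_mean _ _ _ _ _ _ _ P _ _ mS' mY' independent_generated
  (value t) (fun v => m * Y t v) (fun v => 1 + (V * Y t v + m ^+ 2 * (Y t v * Y t v))) _ _
  (measurable_value t0).
have hpsi := has_meanD (has_mean_cst P 1) (has_meanD (has_meanZ V hy) (has_meanZ (m ^+ 2) hz)).
move=> /(_ _ (1 + (V * y + m ^+ 2 * z))) h.
apply: eq_has_mean (h _ _ _ (has_meanZ m hy) hpsi) => [w||v|v]; first exact: valueE.
- by [].
- by apply: eq_has_mean (momS (Y_ge0 t v) (Y_ge0 t v)).1 => [w|//]; rewrite valueE.
- have [I2 <-] := has_meanD (has_mean_cst P 1) (sqr_mean (Y_ge0 t v)).
  apply: ge0_le_integral => //.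
  + apply/measurable_EFinP; apply: measurableT_comp => //.
    apply: eq_measurable_fun (has_mean_measurable (momS (Y_ge0 t v) (Y_ge0 t v)).1) => w _.
    by rewrite /= valueE.
  + exact: measurable_int I2.
  + move=> w _; rewrite lee_fin /= valueE.
    rewrite -(real_normK (num_real (S (Y t v) w))); set x := `|_|.
    nra.
Qed.

(** Conditionally on Y this is the product moment of S at the times Y_s and Y_t;
integrability follows from |x y| <= x^2 + y^2. *)
Lemma subordinated_mean2 s t ys zs yt zt r : 0 <= s -> 0 <= t ->
  has_mean P (Y s) ys -> has_mean P (fun w => Y s w * Y s w) zs ->
  has_mean P (Y t) yt -> has_mean P (fun w => Y t w * Y t w) zt ->
  has_mean P (fun v => V * Num.min (Y s v) (Y t v) + m ^+ 2 * (Y s v * Y t v)) r ->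
  has_mean P (fun w => S (Y s w) w * S (Y t w) w) r.
Proof.
move=> s0 t0 hys hzs hyt hzt hr.
have mS' := measurable_id_generated mS; have mY' := measurable_id_generated mY.
have hpsi := has_meanD
  (has_meanD (has_meanZ V hys) (has_meanZ (m ^+ 2) hzs))
  (has_meanD (has_meanZ V hyt) (has_meanZ (m ^+ 2) hzt)).
have mvalue2 : measurable_fun [set: TS * TY] (fun p => value s p * value t p).
  by apply: measurable_funM; exact: measurable_value.
have := @independent_has_mean _ _ _ _ _ _ _ P _ _ mS' mY' independent_generated
  (fun p => value s p * value t p) _ _ _ _ mvalue2 _ _ hr hpsi.
move=> h; apply: eq_has_mean (h _ _) => [w||v|v] //.
- by rewrite /= !valueE.
- by apply: eq_has_mean (momS (Y_ge0 s v) (Y_ge0 t v)).2 => [w|//]; rewrite !valueE.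
- have hb := has_meanD (sqr_mean (Y_ge0 s v)) (sqr_mean (Y_ge0 t v)).
  rewrite -!expr2 in hb *; have [I2 <-] := hb.
  apply: ge0_le_integral => //.
  + apply/measurable_EFinP; apply: measurableT_comp => //.
    apply: eq_measurable_fun (has_mean_measurable (momS (Y_ge0 s v) (Y_ge0 t v)).2) => w _.
    by rewrite /= !valueE.
  + exact: measurable_int I2.
  + move=> w _; rewrite lee_fin /= !valueE normrM.
    rewrite -(real_normK (num_real (S (Y s v) w))) -(real_normK (num_real (S (Y t v) w))).
    have x0 := normr_ge0 (S (Y s v) w); have y0 := normr_ge0 (S (Y t v) w).
    nra.
Qed.

End subordination.

(** * Asymptotics of correlations *)
Section correlation_asymptotics.
Context d (T : measurableType d) (R : realType) (P : probability T R).

Lemma has_mean_covariance (f g : T -> R) a b c : has_mean P f a -> has_mean P g b ->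
  has_mean P (fun w => f w * g w) c -> covariance P f g = (c - a * b)%:E.
Proof.
move=> hf hg hfg; rewrite covarianceE.
- by rewrite (has_mean_expectation hf) (has_mean_expectation hg)
    (has_mean_expectation (hfg : has_mean P (f * g) c)).
- exact: has_mean_Lfun1 hf.
- exact: has_mean_Lfun1 hg.
- exact: (has_mean_Lfun1 (hfg : has_mean P (f * g) c)).
Qed.

(** If the covariance converges and the standard deviation is equivalent to a
multiple of t^gamma, the correlation is equivalent to a multiple of
t^(- gamma). *)
Lemma LRD_of_covariance_limit (X : R -> T -> R) (gamma v : R) (kappa : R -> R) :
  0 < gamma < 1 -> 0 < v -> (forall s, 0 < s -> 0 < kappa s) ->
  (forall t, 0 <= t -> X t \in Lfun P 2%:E) ->
  (forall s, 0 < s -> fine (covariance P (X s) (X t)) @[t --> +oo] --> kappa s) ->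
  (forall t, 0 < t -> 0 < fine ('V_P[X t])%E) ->
  fine ('V_P[X t])%E / (t `^ gamma) ^+ 2 @[t --> +oo] --> v ->
  LRD P X.
Proof.
move=> gamma01 v0 kappa0 LX covX varX limV; split => //.
exists gamma; split => // s s0.
have sV0 : 0 < Num.sqrt (fine ('V_P[X s])%E) by rewrite sqrtr_gt0 varX.
have sv0 : 0 < Num.sqrt v by rewrite sqrtr_gt0.
exists (kappa s / (Num.sqrt (fine ('V_P[X s])%E) * Num.sqrt v)); split.
  by rewrite divr_gt0 ?kappa0// mulr_gt0.
pose ratio t := fine (covariance P (X s) (X t)) / kappa s *
  (Num.sqrt v / Num.sqrt (fine ('V_P[X t])%E / (t `^ gamma) ^+ 2)).
suff lim_ratio : ratio t @[t --> +oo] --> (1 : R).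
  apply: cvg_trans lim_ratio; apply: near_eq_cvg.
  near=> t; have t0 : 0 < t by near: t; exact: nbhs_pinfty_gt (num_real _).
  have p0 : 0 < t `^ gamma by rewrite powR_gt0.
  have Vt0 : 0 < Num.sqrt (fine ('V_P[X t])%E) by rewrite sqrtr_gt0 varX.
  rewrite /ratio /correlation sqrtrM ?(ltW (varX t t0))// sqrtrV ?exprn_ge0 ?(ltW p0)//.
  rewrite sqrtr_sqr gtr0_norm// powRN.
  have k0 := kappa0 s s0; field.
  by rewrite !gt_eqF.
rewrite -(mulr1 1); apply: cvgM.
  rewrite -(divff (lt0r_neq0 (kappa0 s s0))).
  by apply: cvgM; [exact: covX|exact: cvg_cst].
rewrite -(divff (lt0r_neq0 sv0)); apply: cvgM; first exact: cvg_cst.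
apply: cvgV; first by rewrite gt_eqF.
apply: (@cvg_comp _ _ _ _ _ _ _ _ limV); exact: sqrt_continuous.
Unshelve. all: by end_near.
Qed.

Lemma cvg_powRN_pinfty (a : R) : 0 < a -> t `^ (- a) @[t --> +oo] --> (0 : R).
Proof.
move=> a0; under eq_fun do rewrite powRN.
apply/gtr0_cvgV0.
  by near=> t; rewrite powR_gt0//; near: t; exact: nbhs_pinfty_gt (num_real _).
apply/cvgryPge => A; near=> t.
have At : (Num.max A 0) `^ a^-1 <= t by near: t; exact: nbhs_pinfty_ge (num_real _).
have := ge0_ler_powR (ltW a0) _ _ At.
rewrite -powRrM mulVf ?gt_eqF// powRr1 ?le_max ?lexx ?orbT//.
rewrite ge_max => /(_ _ _)/andP[]//.
  by rewrite nnegrE powR_ge0.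
by rewrite nnegrE; apply: le_trans At; exact: powR_ge0.
Unshelve. all: by end_near.
Qed.

(** As 0 < (t - s) / t <= 1, the power ((t - s) / t)^alpha is at least
(t - s) / t, and the increment is at most s t^(alpha - 1). *)
Lemma powR_increment_cvg0 (alpha s : R) : 0 < alpha < 1 -> 0 < s ->
  t `^ alpha - (t - s) `^ alpha @[t --> +oo] --> (0 : R).
Proof.
move=> /andP[alpha0 alpha1] s0.
apply: (@squeeze_cvgr _ _ _ _ (fun=> 0) (fun t => s * t `^ (- (1 - alpha)))).
- near=> t; have st : s < t by near: t; exact: nbhs_pinfty_gt (num_real _).
  have t0 : 0 < t := lt_trans s0 st.
  rewrite subr_ge0 ge0_ler_powR ?nnegrE ?subr_ge0 ?(ltW alpha0) ?(ltW st) ?(ltW t0)//=;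
    last by rewrite gerBl ltW.
  rewrite lerBlDr -lerBlDl.
  rewrite (_ : t - s = t * ((t - s) / t)); last by field; rewrite gt_eqF.
  have q0 : 0 < (t - s) / t by rewrite divr_gt0// subr_gt0.
  have q1 : (t - s) / t <= 1 by rewrite ler_pdivrMr// mul1r gerBl ltW.
  rewrite powRM ?(ltW t0) ?(ltW q0)//.
  have : t `^ alpha * ((t - s) / t) <= t `^ alpha * ((t - s) / t) `^ alpha.
    by rewrite ler_wpM2l ?powR_ge0// ger1_powR ?q0 ?(ltW alpha1).
  apply: le_trans.
  rewrite opprB powRD; last by apply/implyP => _; rewrite gt_eqF.
  rewrite powR_inv1 ?(ltW t0)// le_eqVlt; apply/orP; left; apply/eqP.
  by field; rewrite gt_eqF.
- exact: cvg_cst.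
- rewrite -(mulr0 s); apply: cvgM; first exact: cvg_cst.
  by apply: cvg_powRN_pinfty; rewrite subr_gt0.
Unshelve. all: by end_near.
Qed.

End correlation_asymptotics.

(** * Long-range dependence *)
Section generalized_skellam.
Context d (T : measurableType d) (R : realType) (P : probability T R).
Variables (k : nat) (lambda mu : 'I_k -> R).

Lemma gsp_regular S : generalized_skellam_process P lambda mu S ->
  stochastic_process S /\ right_continuous_paths S.
Proof.
move=> [M1 [M2 [[[mM1 _ _ _ rc1] _] [[mM2 _ _ _ rc2] _] _ SM]]].
split=> [t t0|w t t0].
  rewrite (_ : S t = fun w => M1 t w - M2 t w); last first.
    by apply/funext => w; exact: SM.
  by apply: measurable_funB; [exact: mM1|exact: mM2].
rewrite (SM t w t0).
have h : (fun u => M1 u w - M2 u w) @ t^'+ --> M1 t w - M2 t w.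
  by apply: cvgB; [exact: rc1|exact: rc2].
apply: cvg_trans h; apply: near_eq_cvg.
near=> u; rewrite SM//; apply: (le_trans t0); near: u; exact: nbhs_right_ge.
Unshelve. all: by end_near.
Qed.

Lemma gsp_variance_gt0 : (0 < k)%N -> (forall j, 0 < lambda j) ->
  (forall j, 0 < mu j) -> 0 < \sum_(j < k) j.+1%:R ^+ 2 * (lambda j + mu j).
Proof.
move=> k0 lambda0 mu0; have term (j : 'I_k) : 0 < j.+1%:R ^+ 2 * (lambda j + mu j).
  by rewrite mulr_gt0 ?exprn_gt0// addr_gt0.
rewrite (bigD1 (Ordinal k0))//; apply: (lt_le_trans (term (Ordinal k0))).
by rewrite lerDl; apply: sumr_ge0 => j _; exact: ltW.
Qed.

End generalized_skellam.

Section long_range_dependence.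
Context d (T : measurableType d) (R : realType) (P : probability T R).
Implicit Types (X S Y : R -> T -> R) (m V alpha : R).

(** The covariance V min(s, t) no longer depends on t once t >= s, while the
variance is V t: the exponent is 1/2 for every Levy-type process. *)
Lemma levy_moments_LRD m V X : 0 < V -> levy_moments P m V X -> LRD P X.
Proof.
move=> V0 momX.
have cov s t : 0 <= s -> 0 <= t -> covariance P (X s) (X t) = (V * Num.min s t)%:E.
  move=> s0 t0; rewrite (has_mean_covariance (momX s t s0 t0).1 (momX t t t0 t0).1
    (momX s t s0 t0).2); congr EFin; ring.
apply: (@LRD_of_covariance_limit _ _ _ _ _ 2^-1 V (fun s => V * s)) => //.
- by apply/andP; split; lra.
- by move=> s s0; rewrite mulr_gt0.
- move=> t t0; apply: has_mean_sqr_Lfun2 (has_mean_measurable (momX t t t0 t0).1) _.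
    exact: (momX t t t0 t0).2.
- move=> s s0; apply: cvg_near_cst.
  near=> t; have st : s <= t by near: t; exact: nbhs_pinfty_ge (num_real _).
  by rewrite cov ?(ltW s0) ?(le_trans (ltW s0) st)//= min_l.
- by move=> t t0; rewrite /variance cov ?ltW//= minxx mulr_gt0.
- apply: cvg_near_cst.
  near=> t; have t0 : 0 < t by near: t; exact: nbhs_pinfty_gt (num_real _).
  rewrite /variance cov ?ltW//= minxx powR12_sqrt ?(ltW t0)// sqr_sqrtr ?(ltW t0)//.
  by rewrite mulfK// gt_eqF.
Unshelve. all: by end_near.
Qed.

(** The drift decides the exponent: the fluctuations m Y_t of order t^alpha
dominate the noise of order t^(alpha / 2) unless m = 0. The moments of the
inverse are computed for the centred subordinator and transferred almost surely
to the given one. *)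
Lemma subordinated_LRD m V alpha S D X : 0 < V -> 0 < alpha < 1 ->
  levy_moments P m V S -> stochastic_process S -> right_continuous_paths S ->
  stable_subordinator P alpha D ->
  independent_processes P S (inverse_process D) ->
  (forall t w, 0 <= t -> X t w = S (inverse_process D t w) w) ->
  LRD P X.
Proof.
move=> V0 /[dup] alpha01 /andP[alpha0 alpha1] momS mS rcS stD SD XE.
have hD := centre_subordinator stD.
(* The inverse of the centred process [D'] has the known moments. *)
set D' := (fun x w => _) in hD.
have DD' : forall t, {ae P, forall w, inverse_process D' t w = inverse_process D t w}.
  have [[_ D0 _ _ _] _ _] := stD.
  by move=> t; apply: filterS (inverse_process_centre D0 t) => w ->.
have [u [q [a [[u0 uq] a0 fin1 mom1 mom2]]]] := inverse_subordinator_moments alpha1 hD.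
set Y := inverse_process D in SD DD' XE.
have mY : stochastic_process Y.
  have [[mD _ _ _ [rcD _]] ndD _] := stD.
  exact: measurable_inverse_process.
have Y_ge0 t w : 0 <= Y t w := inverse_process_ge0 D t w.
have toY t y : has_mean P (inverse_process D' t) y -> 0 <= t -> has_mean P (Y t) y.
  by move=> h t0; apply: has_mean_ae h; [exact: mY|exact: DD'].
have toYY s t y : 0 <= s -> 0 <= t ->
    has_mean P (fun w => inverse_process D' s w * inverse_process D' t w) y ->
    has_mean P (fun w => Y s w * Y t w) y.
  move=> s0 t0 h; apply: has_mean_ae h.
    by apply: measurable_funM; exact: mY.
  by apply: filterS2 (DD' s) (DD' t) => w -> ->.
have Yle s t : s <= t -> {ae P, forall w, Y s w <= Y t w}.
  move=> st; apply: filterS3 (DD' s) (DD' t) (inverse_process_nondecreasing hD st) => w.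
  by move=> -> ->.
pose U t := u * t `^ alpha.
have meanX t : 0 < t -> has_mean P (X t) (m * U t).
  move=> t0; have [h1 h2] := mom1 t t0.
  have := subordinated_mean momS mS rcS mY Y_ge0 SD (ltW t0) (toY _ _ h1 (ltW t0))
    (toYY _ _ _ (ltW t0) (ltW t0) h2).
  by apply: eq_has_mean => // w; rewrite XE// ltW.
have meanXX s t c : 0 < s -> s <= t -> has_mean P (fun w => Y s w * Y t w) c ->
    has_mean P (fun w => X s w * X t w) (V * U s + m ^+ 2 * c).
  move=> s0 st hc; have t0 := lt_le_trans s0 st.
  have [s1 s2] := mom1 s s0; have [t1 t2] := mom1 t t0.
  have hr : has_mean P (fun v => V * Num.min (Y s v) (Y t v) + m ^+ 2 * (Y s v * Y t v))
      (V * U s + m ^+ 2 * c).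
    have h := has_meanD (has_meanZ V (toY _ _ s1 (ltW s0))) (has_meanZ (m ^+ 2) hc).
    apply: has_mean_ae h; last by apply: filterS (Yle s t st) => w Yst; rewrite min_l.
    apply: measurable_funD; apply: measurable_funM => //.
      by apply: measurable_minr; apply: mY; exact: ltW.
    by apply: measurable_funM; apply: mY; exact: ltW.
  have := subordinated_mean2 momS mS rcS mY Y_ge0 SD (ltW s0) (ltW t0)
    (toY _ _ s1 (ltW s0)) (toYY _ _ _ (ltW s0) (ltW s0) s2)
    (toY _ _ t1 (ltW t0)) (toYY _ _ _ (ltW t0) (ltW t0) t2) hr.
  by apply: eq_has_mean => // w; rewrite !XE ?(ltW s0) ?(ltW t0).
have LX t : 0 <= t -> X t \in Lfun P 2%:E.
  move=> t0; have [y [z [h1 h2]]] := fin1 t.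
  have h1' := toY _ _ h1 t0; have h2' := toYY _ _ _ t0 t0 h2.
  have hr : has_mean P (fun v => V * Num.min (Y t v) (Y t v) + m ^+ 2 * (Y t v * Y t v))
      (V * y + m ^+ 2 * z).
    apply: eq_has_mean (has_meanD (has_meanZ V h1') (has_meanZ (m ^+ 2) h2')) => // w.
    by rewrite minxx.
  have h := subordinated_mean2 momS mS rcS mY Y_ge0 SD t0 t0 h1' h2' h1' h2' hr.
  have XtE : X t = fun w => S (Y t w) w by apply/funext => w; exact: XE.
  apply: (@has_mean_sqr_Lfun2 _ _ _ _ _ (V * y + m ^+ 2 * z)); rewrite XtE.
    exact: measurable_subordinated.
  exact: h.
have varE t : 0 < t -> fine ('V_P[X t])%E =
    V * U t + m ^+ 2 * ((q - u ^+ 2) * (t `^ alpha) ^+ 2).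
  move=> t0; have [_ h2] := mom1 t t0.
  rewrite /variance (has_mean_covariance (meanX t t0) (meanX t t0)
    (meanXX t t _ t0 (lexx t) (toYY _ _ _ (ltW t0) (ltW t0) h2))) /=.
  by rewrite /U; ring.
have qu0 : 0 < q - u ^+ 2 by rewrite subr_gt0.
have U_gt0 t : 0 < t -> 0 < U t by move=> t0; rewrite mulr_gt0 ?powR_gt0.
have covX (s : R) : 0 < s -> fine (covariance P (X s) (X t)) @[t --> +oo] -->
    V * U s + m ^+ 2 * a s.
  move=> s0.
  apply: (@squeeze_cvgr _ _ _ _
    (fun t => V * U s + m ^+ 2 * (a s - U s * u * (t `^ alpha - (t - s) `^ alpha)))
    (fun=> V * U s + m ^+ 2 * a s)); last exact: cvg_cst.
    near=> t; have st : s < t by near: t; exact: nbhs_pinfty_gt (num_real _).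
    have t0 := lt_trans s0 st.
    have [c [hc /andP[lo up]]] := mom2 s t s0 st.
    rewrite (has_mean_covariance (meanX s s0) (meanX t t0)
      (meanXX s t c s0 (ltW st) (toYY _ _ _ (ltW s0) (ltW t0) hc))) /=.
    have -> : V * U s + m ^+ 2 * c - m * U s * (m * U t) =
        V * U s + m ^+ 2 * (c - U s * U t) by ring.
    apply/andP; split; rewrite lerD2l; apply: ler_wpM2l; rewrite ?sqr_ge0//.
      rewrite lerBrDr; apply: le_trans lo; rewrite le_eqVlt; apply/orP; left.
      by apply/eqP; rewrite /U; ring.
    by rewrite lerBlDr.
  have -> : V * U s + m ^+ 2 * a s = V * U s + m ^+ 2 * (a s - U s * u * 0).
    by rewrite mulr0 subr0.
  apply: cvgD; first exact: cvg_cst.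
  apply: cvgM; first exact: cvg_cst.
  apply: cvgB; first exact: cvg_cst.
  by apply: cvgM; [exact: cvg_cst|exact: powR_increment_cvg0].
have [m0|m0] := eqVneq m 0.
- apply: (@LRD_of_covariance_limit _ _ _ _ _ (alpha / 2) (V * u)
    (fun s => V * U s + m ^+ 2 * a s)) => //.
  + by apply/andP; split; lra.
  + by rewrite mulr_gt0.
  + by move=> s s0; rewrite m0 expr0n mul0r addr0 mulr_gt0 ?U_gt0.
  + by move=> t t0; rewrite varE// m0 expr0n mul0r addr0 mulr_gt0 ?U_gt0.
  + apply: cvg_near_cst.
    near=> t; have t0 : 0 < t by near: t; exact: nbhs_pinfty_gt (num_real _).
    rewrite varE// m0 expr0n mul0r addr0 /U expr2 -powRD; last first.
      by apply/implyP => _; rewrite gt_eqF.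
    by rewrite -splitr mulrA mulfK// gt_eqF// powR_gt0.
- have m20 : 0 < m ^+ 2 by rewrite exprn_even_gt0.
  apply: (@LRD_of_covariance_limit _ _ _ _ _ alpha (m ^+ 2 * (q - u ^+ 2))
    (fun s => V * U s + m ^+ 2 * a s)) => //.
  + by rewrite mulr_gt0.
  + by move=> s s0; rewrite addr_gt0// mulr_gt0 ?U_gt0 ?a0.
  + move=> t t0; rewrite varE// addr_gt0//; first by rewrite mulr_gt0 ?U_gt0.
    by rewrite mulr_gt0// mulr_gt0// exprn_gt0// powR_gt0.
  + have h : V * u * t `^ (- alpha) + m ^+ 2 * (q - u ^+ 2) @[t --> +oo] -->
        m ^+ 2 * (q - u ^+ 2).
      rewrite -[X in _ --> X]add0r -(mulr0 (V * u)).
      apply: cvgD; last exact: cvg_cst.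
      by apply: cvgM; [exact: cvg_cst|exact: cvg_powRN_pinfty].
    apply: cvg_trans h; apply: near_eq_cvg.
    near=> t; have t0 : 0 < t by near: t; exact: nbhs_pinfty_gt (num_real _).
    have p0 : 0 < t `^ alpha by rewrite powR_gt0.
    by rewrite varE// /U powRN; field; rewrite gt_eqF.
Unshelve. all: by end_near.
Qed.

End long_range_dependence.

Theorem proposition3p4 (R : realType) (d : measure_display)
  (T : measurableType d) (P : probability T R)
  (k : nat) (lambda mu : 'I_k -> R) (alpha : R) (X : R -> T -> R)
  (hk : (1 <= k)%N)
  (hlambda : forall j : 'I_k, 0 < lambda j)
  (hmu : forall j : 'I_k, 0 < mu j)
  (halpha : 0 < alpha <= 1)
  (hX : generalized_fractional_skellam_process P alpha lambda mu X) :
  LRD P X.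
Proof.
have V0 := gsp_variance_gt0 hk hlambda hmu.
have [S gS] := hX.
have momS := gsp_levy_moments hlambda hmu gS.
case: eqVneq => [_ XE|alpha_neq1 [D [stD SD XE]]].
  apply: (levy_moments_LRD V0).
  move=> u v u0 v0; have [h1 h2] := momS u v u0 v0.
  by split; [apply: eq_has_mean h1|apply: eq_has_mean h2] => // w; rewrite !XE.
have [mS rcS] := gsp_regular gS.
apply: (subordinated_LRD V0 _ momS mS rcS stD SD XE).
by move: halpha; rewrite le_eqVlt (negbTE alpha_neq1).
Qed.
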